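(* Let $p\ge 1$, $s>1$, $\varepsilon>0$, let $\tau\in\mathcal{T}([0,1];s,\varepsilon)$, and let $q$ be a noise profile. Assume that $\tau$ satisfies the Lasota--Yorke condition with constants $\alpha_0, C_0$, and that the joint expansion--kernel condition $\alpha_0<1/\widetilde{C}_1$ holds. Assume that $\tau$ is topologically mixing, so that $P_\tau$ admits a unique absolutely continuous invariant probability measure, with density $h\in BV_{1,1/p}(I)$. For each $\delta\in(0,1/4)$ let $h_\delta\in BV_{1,1/p}(I)$ be an invariant density of $P_\delta=Q_\delta P_\tau$, i.e. $P_\delta h_\delta=h_\delta$, $h_\delta\ge0$, $\|h_\delta\|_1=1$ (such $h_\delta$ exists). Then $$\|h_\delta-h\|_1\to 0\qquad\text{as }\delta\to0 .$$
   Context: Let $I=[0,1]$, let $m$ be Lebesgue measure on $I$, and let $\|\cdot\|_1$ be the norm of $L^1(I)$. Oscillation and the space $BV_{1,1/p}(I)$: for measurable $f:I\to\mathbb{R}$ and $r>0$ put $\operatorname{Osc}(f,r,x)=\sup\{|f(y_1)-f(y_2)|: y_1,y_2\in(x-r,x+r)\cap I\}$ and $\operatorname{Osc}_1(f,r)=\int_I\operatorname{Osc}(f,r,x)\,dm(x)$. For $p\ge1$, $\operatorname{var}_{1,1/p}(f)=\sup_{0<r\le1} r^{-1/p}\operatorname{Osc}_1(f,r)$; $BV_{1,1/p}(I)$ is the set of $f\in L^1(I)$ with $\operatorname{var}_{1,1/p}(f)<\infty$, normed by $\|f\|_{1,1/p}=\operatorname{var}_{1,1/p}(f)+\|f\|_1$.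 It is a Banach space, continuously embedded in $L^1(I)$, and its unit ball is relatively compact in $L^1(I)$. The class $\mathcal{T}([0,1];s,\varepsilon)$: a map $\tau:I\to I$ belongs to it if there is a finite partition $0=a_0<a_1<\dots<a_q=1$ (here $q$ is an integer, unrelated to the noise profile below) such that (1) for each $i$, $\tau$ is monotone and $C^{1+\varepsilon}$ on $(a_{i-1},a_i)$, extending continuously to $[a_{i-1},a_i]$; (2) $|\tau'(x)|\ge s>1$ wherever $\tau'$ is defined; (3) $\tau'$ is $\varepsilon$-Hölder continuous on each interval. Topologically mixing is meant in the usual sense: for all nonempty open $U,V\subset I$ there is $N$ with $\tau^n(U)\cap V\ne\emptyset$ for all $n\ge N$. The paper takes from the literature that topological mixing of $\tau$ gives uniqueness of the absolutely continuous invariant probability measure. $P_\tau:L^1(I)\to L^1(I)$ is the Frobenius--Perron operator of $\tau$: $\int_A P_\tau f\,dm=\int_{\tau^{-1}(A)}f\,dm$ for all measurable $A\subset I$. The density $h$ of an absolutely continuous invariant probability measure satisfies $P_\tau h=h$, $h\ge0$, $\|h\|_1=1$. Lasota--Yorke condition for $P_\tau$ (standing assumption): there are constants $0<\alpha_0<1$ and $C_0>0$, depending only on $\tau$, with $\operatorname{var}_{1,1/p}(P_\tau f)\le\alpha_0\|f\|_{1,1/p}+C_0\|f\|_1$ for all $f\in BV_{1,1/p}(I)$; moreover $\alpha_0\le s^{-1/p}$. Noise profile: a $C^1$ function $q:\mathbb{R}\to[0,\infty)$ with $\operatorname{supp}(q)\subset[-1,1]$, $\int_{\mathbb{R}}q(z)\,dz=1$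 and $q'\in L^\infty(\mathbb{R})$. For $\delta\in(0,1/4)$ the periodized kernel is $q_\delta^{\mathrm{per}}(x,y)=\sum_{n\in\mathbb{Z}}\delta^{-1}q\left(\frac{x-y+n}{\delta}\right)$, $x,y\in I$, and $(Q_\delta f)(x)=\int_I q_\delta^{\mathrm{per}}(x,y)f(y)\,dy$. Joint expansion--kernel condition (standing assumption): $\alpha_0<1/\widetilde{C}_1$, where $\widetilde{C}_1=(1+2^{1+1/p})\cdot 2^{1/p}\max\{1,4\|q'\|_\infty\}$. *)

(* Defs.v *)
(* Functions on I = [0, 1] are represented by total functions R -> R of which
   only the values on I matter; elements of L^1(I) are such functions up to
   equality almost everywhere on I. *)
From HB Require Import structures.
From mathcomp Require Import all_boot all_order all_algebra.
From mathcomp Require Import all_classical all_reals all_analysis.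

Set Implicit Arguments.
Unset Strict Implicit.
Unset Printing Implicit Defensive.

Import Order.TTheory GRing.Theory Num.Theory.
Import numFieldNormedType.Exports.

Local Open Scope classical_set_scope.
Local Open Scope ring_scope.

Definition unit_itv {R : realType} : set R := `[0%R, 1%R]%classic.

Definition leb {R : realType} := @lebesgue_measure R.

Definition norm1 {R : realType} (f : R -> R) : \bar R :=
  (\int[leb]_(x in unit_itv) `|f x|%:E)%E.

Definition Osc {R : realType} (f : R -> R) (r x : R) : \bar R :=
  let B := `]x - r, x + r[%classic `&` unit_itv in
  ereal_sup [set `|f y.1 - f y.2|%:E | y in B `*` B].

Definition Osc1 {R : realType} (f : R -> R) (r : R) : \bar R :=
  (\int[leb]_(x in unit_itv) Osc f r x)%E.

Definition var_fun {R : realType} (p : R) (f : R -> R) : \bar R :=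
  ereal_sup [set ((r `^ (- p^-1))%:E * Osc1 f r)%E | r in `]0%R, 1%R]%classic].

(* var_fun depends on pointwise values, while elements of L^1(I), in particular
   those produced by the Frobenius-Perron operator, are only defined almost
   everywhere; the variation of an element of L^1(I) is therefore the least
   variation of its representatives. *)
Definition var {R : realType} (p : R) (f : R -> R) : \bar R :=
  ereal_inf [set var_fun p g | g in
    [set g : R -> R | measurable_fun unit_itv g /\ ae_eq leb unit_itv f g]].

Definition BV {R : realType} (p : R) : set (R -> R) :=
  [set f | leb.-integrable unit_itv (EFin \o f) /\ (var p f < +oo)%E].

Definition normBV {R : realType} (p : R) (f : R -> R) : \bar R :=
  (var p f + norm1 f)%E.

Definition holder_on {R : realType} (eps : R) (D : set R) (f : R -> R) :=
  exists K : R, forall x y, D x -> D y -> `|f x - f y| <= K * `|x - y| `^ eps.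

(* tau is C^{1+eps} and monotone on ]a, b[ and extends continuously to [a, b];
   the values of tau at a and b are unconstrained. *)
Definition good_branch {R : realType} (eps : R) (tau : R -> R) (a b : R) :=
  [/\ {in `]a, b[ &, {homo tau : x y / x <= y}} \/
      {in `]a, b[ &, {homo tau : x y /~ x <= y}},
      {in `]a, b[, forall x, derivable tau x 1} /\
      {in `]a, b[, forall x, {for x, continuous (derive1 tau)}},
      exists2 g : R -> R, {within `[a, b], continuous g} &
                          {in `]a, b[, g =1 tau}
    & holder_on eps `]a, b[%classic (derive1 tau)].

(* class T([0,1]; s, eps) *)
Definition expanding_class {R : realType} (s eps : R) (tau : R -> R) :=
  [/\ {homo tau : x / unit_itv x},
      1 < s,
      exists (k : nat) (a : nat -> R),
        [/\ a 0%N = 0, a k = 1,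
            forall i, (i < k)%N -> a i < a i.+1
          & forall i, (i < k)%N -> good_branch eps tau (a i) (a i.+1)]
    & forall x, x \in `]0, 1[ -> derivable tau x 1 -> s <= `|derive1 tau x|].

Definition topologically_mixing {R : realType} (tau : R -> R) :=
  forall U V : set R, open U -> open V ->
    U `&` unit_itv !=set0 -> V `&` unit_itv !=set0 ->
    exists N : nat, forall n, (N <= n)%N ->
      (iter n tau @` (U `&` unit_itv)) `&` (V `&` unit_itv) !=set0.

Definition is_FP {R : realType} (tau f g : R -> R) :=
  leb.-integrable unit_itv (EFin \o g) /\
  forall A : set R, measurable A -> A `<=` unit_itv ->
    (\int[leb]_(x in A) (g x)%:E =
     \int[leb]_(x in unit_itv `&` tau @^-1` A) (f x)%:E)%E.

(* is_FP determines its last argument up to equality a.e. on I; FP picks a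
   representative. *)
Definition FP {R : realType} (tau f : R -> R) : R -> R :=
  xget (cst 0) [set g | is_FP tau f g].

Definition lasota_yorke {R : realType} (p s : R) (tau : R -> R)
    (alpha0 C0 : R) :=
  [/\ 0 < alpha0 < 1, 0 < C0, alpha0 <= s `^ (- p^-1)
    & forall f : R -> R, BV p f ->
      (var p (FP tau f) <= alpha0%:E * normBV p f + C0%:E * norm1 f)%E].

Definition norm_infty {R : realType} (f : R -> R) : \bar R :=
  ('N[leb]_+oo[EFin \o f])%E.

Definition noise_profile {R : realType} (q : R -> R) :=
  [/\ (forall x, derivable q x 1) /\ continuous (derive1 q),
      forall x, 0 <= q x,
      closure [set x | q x != 0] `<=` `[-1, 1]%classic,
      (\int[leb]_x (q x)%:E = 1)%E
    & (norm_infty (derive1 q) < +oo)%E].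

(* The sum is over the finite support of its argument, which is finite because
   q is supported in [-1, 1]. *)
Definition q_per {R : realType} (q : R -> R) (delta x y : R) : R :=
  \sum_(n \in [set: int]) delta^-1 * q ((x - y + n%:~R) / delta).

Definition Q {R : realType} (q : R -> R) (delta : R) (f : R -> R) : R -> R :=
  fun x => \int[leb]_(y in unit_itv) (q_per q delta x y * f y).

Definition C1tilde {R : realType} (p : R) (q : R -> R) : R :=
  (1 + 2 `^ (1 + p^-1)) * 2 `^ (p^-1)
  * Num.max 1 (4 * fine (norm_infty (derive1 q))).

(* Measures on I are represented by measures on R giving full mass to I. *)
Definition acip {R : realType} (tau : R -> R)
    (nu : probability (measurableTypeR R) R) :=
  [/\ nu unit_itv = 1%E,
      nu `<< leb
    & forall A : set R, measurable A -> A `<=` unit_itv ->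
        nu (unit_itv `&` tau @^-1` A) = nu A].

Definition unique_acip {R : realType} (tau : R -> R)
    (nu : probability (measurableTypeR R) R) :=
  acip tau nu /\
  forall nu' : probability (measurableTypeR R) R, acip tau nu' ->
    forall A : set R, measurable A -> nu' A = nu A.

Definition density {R : realType} (h : R -> R) :=
  {ae leb, forall x, unit_itv x -> 0 <= h x} /\ norm1 h = 1%E.

Definition has_density {R : realType}
    (nu : probability (measurableTypeR R) R) (h : R -> R) :=
  density h /\
  forall A : set R, measurable A -> A `<=` unit_itv ->
    nu A = (\int[leb]_(x in A) (h x)%:E)%E.

Definition invariant_density {R : realType} (P : (R -> R) -> (R -> R))
    (h : R -> R) :=
  ae_eq leb unit_itv (P h) h /\ density h.

(* Main.v *)
Require Import Defs.
From HB Require Import structures.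
From mathcomp Require Import all_boot all_order all_algebra.
From mathcomp Require Import all_classical all_reals all_analysis.
From mathcomp Require Import measurable_realfun zify lra.

Set Implicit Arguments.
Unset Strict Implicit.
Unset Printing Implicit Defensive.

Import Order.TTheory GRing.Theory Num.Theory.
Import numFieldNormedType.Exports.

Local Open Scope classical_set_scope.
Local Open Scope ring_scope.

(** Write P for the Frobenius-Perron operator [FP tau] and Q for the noise. The
    proof has three steps: the densities [h_ delta] have bounded variation
    uniformly in [delta], every weak limit of them is the unique invariant
    probability [nu], and for functions of uniformly bounded variation weak
    convergence implies convergence in L^1.

    The uniform bound rests on the fact that Q is a convolution on the circle
    R/Z ([QE]). An average of rotated copies of [f] oscillates at most as much
    as [f] does along the circle, whatever the scale [delta] is. On the circle
    the oscillation of [f] exceeds the one on the interval only near the point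
    0 = 1, where it is at most the range of [f], itself bounded by the
    variation; altogether Q multiplies the variation by at most 3 ([var_fun_Q]).
    As [C1tilde >= 3], the joint condition gives [3 * alpha0 < 1], and the
    Lasota-Yorke inequality applied to [h_ delta = Q (P (h_ delta))] bounds the
    variation of [h_ delta] ([noisy_density_bounds]). The same convolution
    formula shows that Q moves a function of bounded variation by
    O(delta `^ p^-1) in L^1 ([norm1_Q_sub_le]), so that [h_ delta] is almost
    invariant: the masses that it gives to [A] and to the preimage of [A] by
    [tau] differ by O(delta `^ p^-1).

    For the limit, an ultrafilter on the noise levels makes the masses of all
    measurable sets converge simultaneously. The densities are uniformly
    bounded, so the limit is a measure dominated by a multiple of Lebesgue
    measure; it is invariant, hence equal to [nu] ([ultra_limit_density]).

    Finally, cut the interval into N cells. The L^1 norm of a function is at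
    most the sum of the absolute values of its integrals over the cells, plus
    its oscillation at scale 1 / N ([norm1_le_cells]). For [h_ delta - h] the
    oscillation is small with 1 / N, uniformly in [delta], and the finitely many
    integrals tend to 0 along the ultrafilter. So no ultrafilter finer than the
    neighborhoods of [0^'+] can keep the norm away from 0. *)

(** * Affine substitutions and rotations of the circle *)

(** As functions of [A] both sides are measures on the line, so it suffices to
    compare them on half-open intervals. *)
Lemma leb_affine (R : realType) (c b : R) (A : set R) :
  c != 0 -> measurable A ->
  leb A = (`|c|%:E * leb ((fun x => c * x + b)%R @^-1` A))%E.
Proof.
move=> c0 mA.
pose f (x : measurableTypeR R) : measurableTypeR R := c * x + b.
have mf : measurable_fun setT f.
  by apply: measurable_funD => //; exact: measurable_funM.
pose pf0 := (pushforward (@lebesgue_measure R) f :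
  {measure set (measurableTypeR R) -> \bar R}).
pose pf := pf0 mf.
pose nu := mscale (NngNum (normr_ge0 c)) pf.
rewrite [RHS](_ : _ = nu A) //.
apply: lebesgue_measure_unique => // _ [[x y]] _ <-.
rewrite [RHS](_ : _ = (`|c|%:E * leb (f @^-1` `]x, y]))%E)//.
rewrite /leb [in LHS]lebesgue_measure_itv/=.
have [cp|cn] : 0 < c \/ c < 0 by apply/orP; rewrite orbC -neq_lt.
  have -> : f @^-1` `]x, y] = `](x - b) / c, (y - b) / c]%classic.
    apply/seteqP; split=> z /=; rewrite !in_itv/= /f/= ltr_pdivrMr//
      ler_pdivlMr//;
    by move=> /andP[? ?]; apply/andP; split; nra.
  rewrite lebesgue_measure_itv/= !lte_fin ltr_pM2r ?invr_gt0// ltrD2r.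
  case: ifPn => _; last by rewrite mule0.
  rewrite -!EFinB -EFinM gtr0_norm//; congr (_%:E).
  by rewrite -mulrBl mulrCA divff// mulr1; lra.
have -> : f @^-1` `]x, y] = `[(y - b) / c, (x - b) / c[%classic.
  apply/seteqP; split=> z /=; rewrite !in_itv/= /f/= ltr_ndivlMr//
    ler_ndivrMr//;
  by move=> /andP[? ?]; apply/andP; split; nra.
rewrite lebesgue_measure_itv/= !lte_fin ltr_nM2r ?invr_lt0// ltrD2r.
case: ifPn => _; last by rewrite mule0.
rewrite -!EFinB -EFinM ltr0_norm//; congr (_%:E).
by rewrite -mulrBl mulrCA mulNr divff// mulrN1; lra.
Qed.

Lemma ge0_integral_affine (R : realType) (c b : R) (D : set R)
    (F : R -> \bar R) :
  c != 0 -> measurable D -> measurable_fun D F ->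
  (forall x, D x -> (0 <= F x)%E) ->
  (\int[leb]_(x in D) F x =
   `|c|%:E * \int[leb]_(x in (fun x => c * x + b)%R @^-1` D) F (c * x + b)%R)%E.
Proof.
move=> c0 mD mF F0.
pose f (x : measurableTypeR R) : measurableTypeR R := c * x + b.
have mf : measurable_fun setT f.
  by apply: measurable_funD => //; exact: measurable_funM.
pose pf0 := (pushforward (@lebesgue_measure R) f :
  {measure set (measurableTypeR R) -> \bar R}).
pose pf := pf0 mf.
rewrite -(@ge0_integral_pushforward _ _ _ _ _ f)//=;
  last by move=> x /set_mem /F0.
rewrite -(@ge0_integral_mscale _ _ _ pf D mD
  (NngNum (normr_ge0 c)) F mF F0).
by apply: eq_measure_integral => A mA _; exact: leb_affine.
Qed.

(** The circle R/Z is represented by its fundamental domain [0, 1[: it differs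
    from the unit interval by a null set, and rotations map it bijectively onto
    itself. *)
Definition circle {R : realType} : set R := `[0, 1[%classic.

Definition frac {R : realType} (x : R) : R := x - (Num.floor x)%:~R.

Section frac.
Variable R : realType.
Implicit Types x : R.

Lemma frac_itv x : 0 <= frac x < 1.
Proof.
rewrite /frac subr_ge0; have /andP[-> ] := floor_itv x.
by rewrite intrD ltrBlDr addrC.
Qed.

Lemma circleE x : circle x = (0 <= x < 1) :> Prop.
Proof. by rewrite /circle/= in_itv. Qed.

Lemma frac_circle x : circle (frac x).
Proof. by rewrite circleE frac_itv. Qed.

Lemma measurable_circle : measurable (@circle R).
Proof. exact: measurable_itv. Qed.

Lemma unit_itvE x : unit_itv x = (0 <= x <= 1) :> Prop.
Proof. by rewrite /unit_itv/= in_itv. Qed.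

Lemma measurable_unit_itv : measurable (@unit_itv R).
Proof. exact: measurable_itv. Qed.

Lemma subset_circle : @circle R `<=` unit_itv.
Proof. by move=> x; rewrite circleE unit_itvE => /andP[-> /ltW]. Qed.

Lemma frac_id x : 0 <= x < 1 -> frac x = x.
Proof. by move=> x01; rewrite /frac (@floor_def _ _ 0) ?subr0// add0r. Qed.

Lemma fracDz x (n : int) : frac (x + n%:~R) = frac x.
Proof. by rewrite /frac floorDrz ?intr_int// intrKfloor intrD; lra. Qed.

Lemma fracBz x (n : int) : frac (x - n%:~R) = frac x.
Proof. by rewrite -mulrNz fracDz. Qed.

Lemma frac_fracDl x y : frac (frac x + y) = frac (x + y).
Proof. by rewrite -(fracDz _ (Num.floor x)) addrAC /frac subrK. Qed.

Lemma frac_fracB x y : frac (x - frac y) = frac (x - y).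
Proof. by rewrite -(fracBz _ (Num.floor y)) -addrA -opprD /frac subrK. Qed.

Lemma measurable_frac : measurable_fun setT (@frac R).
Proof.
move=> _ A mA; rewrite setTI.
have -> : @frac R @^-1` A = \bigcup_(n : int)
   (`[n%:~R, (n + 1)%:~R[%classic `&` (fun x => x - n%:~R) @^-1` A).
  apply/seteqP; split => x /= => [Ax|[n _ [/=]]].
    by exists (Num.floor x) => //; split => //=; rewrite in_itv/= floor_itv.
  by rewrite in_itv/= => /floor_def <-.
apply: countable_bigcupT_measurable => // n; apply: measurableI => //.
have /(_ measurableT A mA) : measurable_fun setT (fun x : R => x - n%:~R).
  exact: measurable_funB.
by rewrite setTI.
Qed.

End frac.
#[export] Hint Extern 0 (@measurable _ _ (@circle _)) =>
  solve [exact: measurable_circle] : core.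
#[export] Hint Extern 0 (@measurable _ _ (@unit_itv _)) =>
  solve [exact: measurable_unit_itv] : core.
#[export] Hint Resolve frac_circle : core.

Lemma ge0_integral_shift (R : realType) (b0 b1 : bool) (t a b : R)
    (F : R -> \bar R) :
  measurable_fun setT F -> (forall x, (0 <= F x)%E) ->
  (\int[leb]_(x in [set` Interval (BSide b0 a) (BSide b1 b)]) F (x + t)%R =
   \int[leb]_(x in
     [set` Interval (BSide b0 (a + t)%R) (BSide b1 (b + t)%R)]) F x)%E.
Proof.
move=> mF F0; rewrite [RHS](@ge0_integral_affine R 1 t)//;
  last exact: measurable_funTS.
rewrite normr1 mul1e.
under [RHS]eq_integral do rewrite mul1r.
congr (integral _ _ _); apply/seteqP; split => x /=; rewrite mul1r;
by move: b0 b1 => [] []; rewrite !in_itv/= => /andP[? ?];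
  apply/andP; split; lra.
Qed.

Lemma ge0_integral_itv_split (R : realType) (a c b : itv_bound R)
    (F : R -> \bar R) :
  measurable_fun setT F -> (forall x, (0 <= F x)%E) ->
  (a <= c)%O -> (c <= b)%O ->
  (\int[leb]_(x in [set` Interval a b]) F x =
   \int[leb]_(x in [set` Interval a c]) F x +
   \int[leb]_(x in [set` Interval c b]) F x)%E.
Proof.
move=> mF F0 ac cb; rewrite (itv_bndbnd_setU ac cb).
apply: ge0_integral_setU => //; first exact: measurable_funTS.
apply/disj_setPS => x [/=]; rewrite !itv_boundlr => /andP[_ xc] /andP[cx _].
by have := le_trans xc cx; rewrite bnd_simp ltxx.
Qed.

(** Rotation invariance of Lebesgue measure on the circle. Once [t] is reduced
    to its fractional part, the translated domain is [t, 1 + t[; the part beyond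
    1 is brought back to [0, t[ by periodicity. *)
Lemma ge0_integral_frac_shift (R : realType) (t : R) (F : R -> \bar R) :
  measurable_fun circle F -> (forall x, circle x -> (0 <= F x)%E) ->
  (\int[leb]_(x in circle) F (frac (x + t)) = \int[leb]_(x in circle) F x)%E.
Proof.
move=> mF F0; pose G := F \o frac.
have G0 x : (0 <= G x)%E by apply: F0; exact: frac_circle.
have mG : measurable_fun setT G.
  apply: (measurable_comp _ _ mF);
    [exact: measurable_circle| |exact: measurable_frac].
  by move=> _ [x _ <-]; exact: frac_circle.
have /andP[t0 t1] := frac_itv t.
transitivity (\int[leb]_(x in circle) G (x + frac t)%R)%E.
  by apply: eq_integral => x _; rewrite /G/= ![(x + _)%R]addrC frac_fracDl.
rewrite /circle ge0_integral_shift// add0r.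
rewrite (@ge0_integral_itv_split _ _ (BLeft 1)) ?bnd_simp//; [|lra|lra].
rewrite -{2}[1%R]add0r [(1 + _)%R]addrC -(ge0_integral_shift _ _ 1)//.
under [X in (_ + X)%E]eq_integral.
  by move=> x _; rewrite /G/= -[1%R]/(1%:~R) fracDz; over.
rewrite addeC -ge0_integral_itv_split ?bnd_simp//; last lra.
apply: eq_integral => x /set_mem/=; rewrite in_itv/= => /frac_id xE.
by rewrite /G/= xE.
Qed.

(** The substitution that puts the variable of a convolution on the other
    factor. *)
Lemma ge0_integral_frac_flip (R : realType) (t : R) (F : R -> \bar R) :
  measurable_fun circle F -> (forall x, circle x -> (0 <= F x)%E) ->
  (\int[leb]_(x in circle) F (frac (t - x)) = \int[leb]_(x in circle) F x)%E.
Proof.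
move=> mF F0; pose G := fun x => F (frac (x + t)).
have G0 x : (0 <= G x)%E by apply: F0; exact: frac_circle.
have mG : measurable_fun setT G.
  apply: (measurable_comp _ _ mF); [exact: measurable_circle| |].
    by move=> _ [x _ <-]; exact: frac_circle.
  apply: measurableT_comp; first exact: measurable_frac.
  exact: measurable_funD.
transitivity (\int[leb]_(x in circle) G (- x)%R)%E.
  by apply: eq_integral => x _; rewrite /G/= addrC.
transitivity (\int[leb]_(x in `](- 1)%R, 0%R]) G x)%E.
  rewrite [RHS](@ge0_integral_affine R (-1) 0)//; last exact: measurable_funTS.
  rewrite normrN normr1 mul1e.
  under [RHS]eq_integral do rewrite mulN1r addr0.
  congr (integral _ _ _); rewrite /circle; apply/seteqP.
  split => x /=; rewrite mulN1r addr0 !in_itv/=;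
  move=> /andP[? ?]; apply/andP; split; lra.
rewrite -integral_itv_bndo_bndc; last exact: measurable_funTS.
rewrite integral_itv_obnd_cbnd; last exact: measurable_funTS.
have -> : `[(-1)%R, 0%R[%classic = `[(0 + -1)%R, (1 + -1)%R[%classic :> set R.
  by rewrite add0r subrr.
rewrite -ge0_integral_shift//.
transitivity (\int[leb]_(x in circle) G x)%E.
  by apply: eq_integral => x _; rewrite /G addrAC -mulrN1z fracDz.
exact: ge0_integral_frac_shift.
Qed.

Lemma integral_frac_flip (R : realType) (t : R) (F : R -> \bar R) :
  measurable_fun circle F ->
  (\int[leb]_(x in circle) F (frac (t - x)) = \int[leb]_(x in circle) F x)%E.
Proof.
move=> mF; rewrite integralE [RHS]integralE; congr (_ - _)%E.
- rewrite -(ge0_integral_frac_flip t (measurable_funepos mF)).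
    by apply: eq_integral => x _; rewrite !funeposE.
  by move=> x _; exact: funepos_ge0.
- rewrite -(ge0_integral_frac_flip t (measurable_funeneg mF)).
    by apply: eq_integral => x _; rewrite !funenegE.
  by move=> x _; exact: funeneg_ge0.
Qed.

(** * The periodized kernel as a convolution kernel on the circle *)

Section kernel.
Variables (R : realType) (q : R -> R) (d : R).
Hypotheses (qN : noise_profile q) (d0 : 0 < d) (d4 : d < 1 / 4).

Lemma noise_profile_eq0 x : 1 < `|x| -> q x = 0.
Proof.
move=> x1; apply/eqP/negPn/negP => qx0.
case: qN => _ _ /(_ x) + _ _ =>
  /(_ (@subset_closure _ [set x | q x != 0] _ qx0)).
by rewrite /= in_itv/= -ler_norml leNgt x1.
Qed.

Lemma measurable_noise_profile : measurable_fun setT q.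
Proof.
case: qN => -[dq _] _ _ _ _; apply: continuous_measurable_fun => x.
exact/differentiable_continuous/derivable1_diffP.
Qed.

(** The periodization of [d^-1 * q (u / d)], for [u] in [0, 1[: as [d < 1 / 4],
    only the translates centered at 0 and at 1 reach that interval. *)
Definition circle_kernel (u : R) : R :=
  d^-1 * q (u / d) + d^-1 * q ((u - 1) / d).

Lemma scaled_eq0 (u : R) : 1 / 4 <= `|u| -> q (u / d) = 0.
Proof.
move=> u1; apply: noise_profile_eq0; rewrite normrM normfV (gtr0_norm d0).
by rewrite ltr_pdivlMr// mul1r (lt_le_trans d4).
Qed.

(** Reindexing by the integer part of [x - y] leaves the terms [u + n] with [u]
    in [0, 1[, of which only [n = 0] and [n = -1] meet the support of [q]. *)
Lemma q_perE x y : q_per q d x y = circle_kernel (frac (x - y)).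
Proof.
pose m := Num.floor (x - y); pose u := frac (x - y).
have /andP[u0 u1] : 0 <= u < 1 := frac_itv _.
have bm : bijective (fun n : int => n - m).
  by exists (fun n => n + m) => n; rewrite ?subrK ?addrK.
rewrite /q_per (@reindex_fsbigT _ _ _ _ _ (fun n : int => n - m))//.
pose F (n : int) := d^-1 * q ((u + n%:~R) / d).
rewrite (_ : \sum_(_ \in _) _ = \sum_(n \in [set: int]) F n); last first.
  apply: eq_fsbigr => n _; rewrite /F /u /frac intrB -/m; congr (_ * q (_ / _)).
  by lra.
rewrite -(@fsbig_widen _ _ _ _ ([set 0] `|` [set (-1)])) //; last first.
  move=> n /= [_ /not_orP[/eqP n0 /eqP n1]]; rewrite /F scaled_eq0 ?mulr0//.
  have [n2|n2] : (1 <= n \/ n <= -2) by lia.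
    have : 1 <= n%:~R :> R by rewrite -[1]/(1%:~R) ler_int.
    by move=> ?; rewrite ger0_norm; lra.
  have : n%:~R <= -2 :> R by rewrite -[2]/(2%:~R) -mulrNz ler_int.
  by move=> ?; rewrite ler0_norm; lra.
rewrite fsbigU0//=; last by move=> n /= [-> ].
by rewrite !fsbig_set1 /F /= addr0 /circle_kernel mulrN1z.
Qed.

Lemma circle_kernel_ge0 u : 0 <= circle_kernel u.
Proof.
case: qN => _ q0 _ _ _.
by rewrite addr_ge0// mulr_ge0// invr_ge0 ltW.
Qed.

Lemma measurable_circle_kernel : measurable_fun setT circle_kernel.
Proof.
apply: measurable_funD; apply: measurable_funM => //;
  apply: (measurableT_comp measurable_noise_profile).
- exact: measurable_funM.
- by apply: measurable_funM => //; exact: measurable_funB.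
Qed.

(** The two terms of the kernel are the restrictions of one rescaled profile to
    [0, 1[ and to [-1, 0[, so its mass is the mass of [q] on the line. *)
Lemma integral_circle_kernel :
  (\int[leb]_(u in circle) (circle_kernel u)%:E = 1)%E.
Proof.
case: qN => _ q0 _ intq _.
pose G (u : R) := (d^-1 * q (u / d))%:E.
have G0 u : (0 <= G u)%E by rewrite lee_fin mulr_ge0// invr_ge0 ltW.
have mG : measurable_fun setT G.
  apply/measurable_EFinP/measurable_funM => //.
  apply: (measurableT_comp measurable_noise_profile); exact: measurable_funM.
transitivity (\int[leb]_(u in circle) (G u + G (u + -1)%R)%E)%E.
  by apply: eq_integral.
rewrite ge0_integralD//=; last 2 first.
- exact: measurable_funTS.
- apply: measurable_funTS; apply: (measurableT_comp mG); exact: measurable_funD.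
rewrite /circle [X in (_ + X)%E]ge0_integral_shift// add0r subrr addeC.
rewrite -ge0_integral_itv_split ?bnd_simp//.
have dn : d^-1 != 0 by rewrite invr_eq0 gt_eqF.
have mq : measurable_fun setT (fun x => (q x)%:E).
  by apply/measurable_EFinP; exact: measurable_noise_profile.
have q0' x : setT x -> (0 <= (q x)%:E)%E by rewrite lee_fin.
rewrite -[RHS]intq (ge0_integral_affine 0 dn measurableT mq q0').
rewrite preimage_setT -ge0_integralZl//; last 2 first.
- apply: (measurableT_comp mq).
  by apply: measurable_funD => //; exact: measurable_funM.
- by move=> u _; exact: q0'.
rewrite [LHS]integral_mkcond; apply: eq_integral => u _.
rewrite patchE addr0 [(d^-1 * u)%R]mulrC gtr0_norm ?invr_gt0// -EFinM.
case: ifPn => // /negP uI; rewrite scaled_eq0 ?mulr0//.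
rewrite leNgt; apply/negP; rewrite ltr_norml => /andP[? ?]; apply: uI.
by rewrite inE/= in_itv/=; apply/andP; split; lra.
Qed.

(** The noise averages the rotated copies of [f] with weights independent of
    [x]. All the regularity of [Q q d f] therefore comes from that of [f], with
    constants that do not involve [d]. *)
Lemma QE (f : R -> R) x : measurable_fun unit_itv f ->
  Q q d f x = \int[leb]_(u in circle) (circle_kernel u * f (frac (x - u))).
Proof.
move=> mf; rewrite /Q /Rintegral; congr fine.
have mfc : measurable_fun circle f.
  by apply: (measurable_funS _ (@subset_circle R) mf);
    exact: measurable_unit_itv.
have mK : measurable_fun circle (fun u => circle_kernel u * f (frac (x - u))).
  apply: measurable_funM.
    by apply: measurable_funTS; exact: measurable_circle_kernel.
  apply: (measurable_comp _ _ mfc); [exact: measurable_circle| |].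
    by move=> _ [u _ <-]; exact: frac_circle.
  apply/measurable_funTS; apply: measurableT_comp; first exact: measurable_frac.
  exact: measurable_funB.
rewrite -(integral_frac_flip x); last exact/measurable_EFinP.
rewrite /unit_itv -integral_itv_bndo_bndc.
  apply: eq_integral => y /set_mem/=; rewrite in_itv/= => y01.
  by rewrite frac_fracB subKr [frac y]frac_id// q_perE.
apply/measurable_EFinP/measurable_funM; last exact: mfc.
rewrite [X in measurable_fun _ X](_ : _ =
    fun y => circle_kernel (frac (x - y))); last first.
  by apply/funext => y; exact: q_perE.
apply/measurable_funTS; apply: (measurableT_comp measurable_circle_kernel).
apply: measurableT_comp; first exact: measurable_frac.
exact: measurable_funB.
Qed.

End kernel.

(** * Oscillation on the interval and on the circle *)

Section oscillation.
Variable R : realType.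
Implicit Types (f : R -> R) (r x M p : R).

Lemma Osc_ge0 f r x : 0 < r -> unit_itv x -> (0 <= Osc f r x)%E.
Proof.
move=> r0 Ix; apply: ereal_sup_ubound; exists (x, x);
  last by rewrite subrr normr0.
by split; split=> //=; rewrite in_itv/=; apply/andP; split; lra.
Qed.

Lemma le_Osc f r x y z :
  unit_itv y -> unit_itv z -> `|y - x| < r -> `|z - x| < r ->
  (`|f y - f z|%:E <= Osc f r x)%E.
Proof.
move=> Iy Iz; rewrite !ltr_norml => /andP[? ?] /andP[? ?].
apply: ereal_sup_ubound; exists (y, z) => //.
by split; split=> //=; rewrite in_itv/=; apply/andP; split; lra.
Qed.

Lemma Osc_le f r x (c : \bar R) :
  (forall y z, unit_itv y -> unit_itv z -> `|y - x| < r -> `|z - x| < r ->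
    (`|f y - f z|%:E <= c)%E) -> (Osc f r x <= c)%E.
Proof.
move=> H; apply: ge_ereal_sup => _ [[y z] [[/= yx Iy] [/= zx Iz]] <-].
move: yx zx; rewrite !in_itv/= => /andP[? ?] /andP[? ?].
by apply: H => //; rewrite ltr_norml; apply/andP; split; lra.
Qed.

(** The oscillation is lower semicontinuous in [x]: it exceeds [a] as soon as
    the open ball around [x] contains one pair of points with a gap larger than
    [a]. *)
Lemma measurable_Osc f r : measurable_fun setT (Osc f r).
Proof.
apply: lower_semicontinuous_measurable; apply/lower_semicontinuousP => a.
rewrite (_ : mkset _ = \bigcup_(w in [set w : R * R |
    [/\ unit_itv w.1, unit_itv w.2 & a < `|f w.1 - f w.2|]])
    (`]w.1 - r, w.1 + r[ `&` `]w.2 - r, w.2 + r[)%classic); last first.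
  apply/seteqP; split => x /=.
    move=> /ereal_sup_gtP[_ [[y z] [[/= yx Iy] [/= zx Iz]] <-]];
      rewrite lte_fin => ayz.
    exists (y, z) => //=; move: yx zx;
      rewrite !in_itv/= => /andP[? ?] /andP[? ?].
    by split; apply/andP; split; lra.
  move=> [[y z] [/= Iy Iz ayz] []]; rewrite !in_itv/= => /andP[? ?] /andP[? ?].
  apply: (@lt_le_trans _ _ (`|f y - f z|%:E)); first by rewrite lte_fin.
  by apply: le_Osc => //; rewrite ltr_norml; apply/andP; split; lra.
by apply: bigcup_open => w _; apply: openI; exact: interval_open.
Qed.

Lemma integral_unit_itv (F : R -> \bar R) : measurable_fun circle F ->
  (\int[leb]_(x in unit_itv) F x = \int[leb]_(x in circle) F x)%E.
Proof. by move=> mF; rewrite /unit_itv -integral_itv_bndo_bndc. Qed.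

Lemma leb_unit_itv : leb (@unit_itv R) = 1%E.
Proof.
by rewrite /leb /unit_itv lebesgue_measure_itv/= lte_fin ltr01 oppr0 adde0.
Qed.

Lemma Osc1_le f p M r : (var_fun p f <= M%:E)%E -> 0 < r -> r <= 1 ->
  (Osc1 f r <= (r `^ p^-1 * M)%:E)%E.
Proof.
move=> fM r0 r1.
have : ((r `^ (- p^-1))%:E * Osc1 f r <= M%:E)%E.
  apply: le_trans fM; apply: ereal_sup_ubound; exists r => //=.
  by rewrite in_itv/= r0.
have rp : 0 < r `^ p^-1 by exact: powR_gt0.
rewrite powRN muleC lee_pdivrMr// => /le_trans; apply.
by rewrite -EFinM mulrC.
Qed.

(** At scale 1 the ball around an interior point is the whole interval, so the
    variation bounds the range of [f]. *)
Lemma range_le f p M y z : (var_fun p f <= M%:E)%E ->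
  unit_itv y -> unit_itv z -> `|f y - f z| <= M.
Proof.
move=> fM Iy Iz; have := Osc1_le fM ltr01 (lexx _).
rewrite powR1 mul1r => fM1; rewrite -lee_fin; apply: le_trans fM1.
have : (\int[leb]_(x in `]0%R, 1%R[) `|f y - f z|%:E <= Osc1 f 1)%E.
  apply: (@le_trans _ _ (\int[leb]_(x in `]0%R, 1%R[) Osc f 1 x)%E).
    apply: ge0_le_integral => //.
    - by apply: measurable_funTS; exact: measurable_Osc.
    - move=> x; rewrite /= in_itv/= => /andP[? ?].
      move: Iy Iz; rewrite !unit_itvE => /andP[? ?] /andP[? ?].
      by apply: le_Osc; rewrite ?unit_itvE ?ltr_norml; apply/andP; split; lra.
  apply: ge0_subset_integral => //.
  - by apply: measurable_funTS; exact: measurable_Osc.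
  - by move=> x Ix; exact: Osc_ge0.
  - by apply: subset_itv; rewrite bnd_simp.
rewrite integral_cst//= [lebesgue_measure _](_ : _ = 1%E) ?mule1//.
by rewrite lebesgue_measure_itv/= lte_fin ltr01 oppr0 adde0.
Qed.

(** A majorant for the oscillation of [f] along the circle. A ball of radius [r]
    on the circle extends across the point 0 = 1, beyond which [Osc] does not
    look, only if its center is within [r] of an endpoint; there the range [M]
    of [f] is used. *)
Definition circle_osc f r M x : \bar R :=
  (Osc f r x + (M * (\1_(`[0, r]%classic : set R) x +
                     \1_(`[1 - r, 1]%classic : set R) x))%:E)%E.

Lemma circle_osc_ge0 f r M x : 0 < r -> 0 <= M -> unit_itv x ->
  (0 <= circle_osc f r M x)%E.
Proof.
move=> r0 M0 Ix; apply: adde_ge0; first exact: Osc_ge0.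
by rewrite lee_fin mulr_ge0// addr_ge0// indicE ler0n.
Qed.

Lemma measurable_circle_osc f r M : measurable_fun setT (circle_osc f r M).
Proof.
apply: emeasurable_funD; first exact: measurable_Osc.
apply/measurable_EFinP/measurable_funM => //; apply: measurable_funD;
exact: measurable_indic.
Qed.

Lemma le_circle_osc f r M w t1 t2 :
  (forall y z, unit_itv y -> unit_itv z -> `|f y - f z| <= M) ->
  circle w -> `|t1| < r -> `|t2| < r ->
  (`|f (frac (w + t1)) - f (frac (w + t2))|%:E <= circle_osc f r M w)%E.
Proof.
move=> fM cw t1r t2r; have := cw; rewrite circleE => /andP[w0 w1].
have fI u : unit_itv (@frac R u) by apply: subset_circle; exact: frac_circle.
have r0 : 0 < r by exact: le_lt_trans t1r.
have M0 : 0 <= M by apply: le_trans (fM _ _ (fI w) (fI w)).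
have Iw := subset_circle cw.
rewrite /circle_osc !indicE.
have [wr|wr] := leP w r.
  rewrite (@mem_set _ _ w) /=; last by rewrite in_itv/= w0.
  rewrite -[X in (X <= _)%E]add0e; apply: leeD; first exact: Osc_ge0.
  rewrite lee_fin (le_trans (fM _ _ (fI _) (fI _)))// mulrDr mulr1 lerDl.
  by rewrite mulr_ge0.
have [rw|wr'] := leP (1 - r) w.
  rewrite (@mem_set _ `[1 - r, 1]%classic w) /=;
    last by rewrite in_itv/= rw ltW.
  rewrite -[X in (X <= _)%E]add0e; apply: leeD; first exact: Osc_ge0.
  rewrite lee_fin (le_trans (fM _ _ (fI _) (fI _)))// mulrDr mulr1 lerDr.
  by rewrite mulr_ge0.
rewrite -[X in (X <= _)%E]adde0; apply: leeD; last first.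
  by rewrite lee_fin mulr_ge0// addr_ge0.
move: (t1r) (t2r); rewrite !ltr_norml => /andP[? ?] /andP[? ?].
rewrite !frac_id; [|apply/andP; split; lra..].
apply: le_Osc; rewrite ?unit_itvE; [apply/andP; split; lra..| |].
- by rewrite addrC addKr.
- by rewrite addrC addKr.
Qed.

(** The endpoints cost [2 * r * M], and [r <= r `^ p^-1] because [r <= 1 <= p].
    Hence the constant 3 = 1 + 2, the expansion factor of the noise. *)
Lemma integral_circle_osc f p r M : 1 <= p -> (var_fun p f <= M%:E)%E ->
  0 < r -> r <= 1 ->
  (\int[leb]_(x in circle) circle_osc f r M x <= (3 * r `^ p^-1 * M)%:E)%E.
Proof.
move=> p1 fM r0 r1.
have I0 : unit_itv (0 : R) by rewrite unit_itvE lexx ler01.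
have M0 : 0 <= M by apply: le_trans (range_le fM I0 I0).
rewrite /circle_osc ge0_integralD//=; last 4 first.
- by move=> x /subset_circle; exact: Osc_ge0.
- by apply: measurable_funTS; exact: measurable_Osc.
- by move=> x _; rewrite lee_fin mulr_ge0// addr_ge0// indicE ler0n.
- apply/measurable_EFinP/measurable_funM => //; apply: measurable_funD;
  exact: measurable_indic.
rewrite -integral_unit_itv; last first.
  by apply: measurable_funTS; exact: measurable_Osc.
have rrp : r <= r `^ p^-1.
  apply: ger1_powR; first by rewrite r0.
  by rewrite invf_le1// (lt_le_trans ltr01).
have -> : 3 * r `^ p^-1 * M = r `^ p^-1 * M + M * (r `^ p^-1 + r `^ p^-1)
  by lra.
rewrite EFinD; apply: leeD; first exact: Osc1_le.
under eq_integral do rewrite EFinM EFinD.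
rewrite ge0_integralZl//; last 2 first.
- by apply: emeasurable_funD; apply/measurable_EFinP; exact: measurable_indic.
- by move=> x _; rewrite adde_ge0// lee_fin indicE ler0n.
rewrite EFinM; apply: lee_wpmul2l => //; rewrite ge0_integralD//=;
  [|by apply/measurable_EFinP; exact: measurable_indic..].
rewrite !integral_indic//= EFinD; apply: leeD.
- apply: (@le_trans _ _ (leb (`[0, r]%classic : set R))).
    by apply: le_measure; rewrite ?inE//=; exact: measurableI.
  by rewrite /leb lebesgue_measure_itv/= lte_fin r0 oppr0 adde0 lee_fin.
- apply: (@le_trans _ _ (leb (`[1 - r, 1]%classic : set R))).
    by apply: le_measure; rewrite ?inE//=; exact: measurableI.
  rewrite /leb lebesgue_measure_itv/= lte_fin ifT; last lra.
  by rewrite -EFinB lee_fin; lra.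
Qed.

End oscillation.

(** * The noise operator on functions of bounded variation *)

Section circle_fubini.
Variable R : realType.
Implicit Types G : R * R -> \bar R.

Let measurable_restr G (D : set (R * R)) : measurable D ->
  measurable_fun setT G -> measurable_fun setT (G \_ D).
Proof.
by move=> mD mG; apply/(measurable_restrictT _ mD); exact: measurable_funTS.
Qed.

Let measurable_strip : measurable (setT `*` circle : set (R * R)).
Proof. exact: measurableX. Qed.

Lemma measurable_integral_circle G : measurable_fun setT G ->
  measurable_fun setT (fun x => \int[leb]_(u in circle) G (x, u))%E.
Proof.
move=> mG.
have H (F : R * R -> \bar R) :
    measurable_fun setT F -> (forall z, 0 <= F z)%E ->
    measurable_fun setT (fun x => \int[leb]_(u in circle) F (x, u))%E.
  move=> mF F0; rewrite [X in measurable_fun _ X](_ : _ =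
    fubini_F (@lebesgue_measure R) (F \_ (setT `*` circle))).
    apply: measurable_fun_fubini_tonelli_F.
      by apply: measurable_restr => //; exact: measurable_strip.
    by move=> z; rewrite patchE; case: ifPn.
  apply/funext => x; rewrite /fubini_F [LHS]integral_mkcond;
    apply: eq_integral => u _.
  by rewrite !patchE in_setX in_setT.
rewrite [X in measurable_fun _ X](_ : _ = fun x =>
  (\int[leb]_(u in circle) G^\+ (x, u) -
   \int[leb]_(u in circle) G^\- (x, u))%E).
  apply: emeasurable_funB; apply: H.
  - exact: measurable_funepos.
  - by move=> z; exact: funepos_ge0.
  - exact: measurable_funeneg.
  - by move=> z; exact: funeneg_ge0.
apply/funext => x; rewrite integralE; congr (_ - _)%E;
  apply: eq_integral => u _.
- by rewrite !funeposE.
- by rewrite !funenegE.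
Qed.

Lemma fubini_circle G : measurable_fun setT G ->
  (forall x u, circle x -> circle u -> 0 <= G (x, u))%E ->
  (\int[leb]_(x in circle) \int[leb]_(u in circle) G (x, u) =
   \int[leb]_(u in circle) \int[leb]_(x in circle) G (x, u))%E.
Proof.
move=> mG G0; pose H := G \_ (circle `*` circle).
have mC : measurable (circle `*` circle : set (R * R)) by exact: measurableX.
have mH : measurable_fun setT H by exact: measurable_restr.
have H0 z : (0 <= H z)%E.
  rewrite /H patchE; case: ifPn => //; rewrite inE; case: z => x u [] /=.
  exact: G0.
have := fubini_tonelli (m1 := @lebesgue_measure R)
  (m2 := @lebesgue_measure R) H mH H0.
have E1 : (\int[leb]_(x in circle) \int[leb]_(u in circle) G (x, u) =
    \int[leb]_x \int[leb]_u H (x, u))%E.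
  rewrite [LHS]integral_mkcond; apply: eq_integral => x _; rewrite patchE.
  case: ifPn => [xC|xC].
    rewrite [LHS]integral_mkcond; apply: eq_integral => u _.
    by rewrite /H !patchE in_setX xC.
  rewrite integral0_eq// => u _.
  by rewrite /H patchE in_setX (negbTE xC).
have E2 : (\int[leb]_(u in circle) \int[leb]_(x in circle) G (x, u) =
    \int[leb]_u \int[leb]_x H (x, u))%E.
  rewrite [LHS]integral_mkcond; apply: eq_integral => u _; rewrite patchE.
  case: ifPn => [uC|uC].
    rewrite [LHS]integral_mkcond; apply: eq_integral => x _.
    by rewrite /H !patchE in_setX uC andbT.
  rewrite integral0_eq// => x _.
  by rewrite /H patchE in_setX (negbTE uC) andbF.
by rewrite E1 E2.
Qed.

End circle_fubini.

Section noise_operator.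
Variables (R : realType) (q : R -> R) (d : R).
Hypotheses (qN : noise_profile q) (d0 : 0 < d) (d4 : d < 1 / 4).
Implicit Types (f : R -> R) (p M : R).
Local Notation kappa := (circle_kernel q d).

Let measurable_frac_comp f : measurable_fun unit_itv f ->
  measurable_fun setT (f \o frac).
Proof.
move=> mf; apply: (measurable_comp _ _ mf); [exact: measurable_unit_itv| |].
  by move=> _ [u _ <-]; apply: subset_circle; exact: frac_circle.
exact: measurable_frac.
Qed.

Lemma measurable_Q f : measurable_fun unit_itv f ->
  measurable_fun unit_itv (Q q d f).
Proof.
move=> mf; apply: measurable_funTS.
pose G (z : R * R) := (kappa z.2 * (f \o frac) (z.1 - z.2))%:E.
rewrite (_ : Q q d f = fine \o (fun x => \int[leb]_(u in circle) G (x, u))%E).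
  apply: measurableT_comp => //; apply: measurable_integral_circle.
  apply/measurable_EFinP/measurable_funM.
    apply: (@measurableT_comp _ _ _ _ _ _ kappa setT (fun z : R * R => z.2)).
      exact: measurable_circle_kernel.
    exact: measurable_snd.
  apply: (measurableT_comp (measurable_frac_comp mf)).
  exact: measurable_funB.
by apply/funext => x; rewrite QE.
Qed.

Lemma integrable_kernel (g : R -> R) M : measurable_fun circle g ->
  (forall u, circle u -> `|g u| <= M) ->
  leb.-integrable circle (EFin \o (fun u => kappa u * g u)).
Proof.
move=> mg gM.
have mk : measurable_fun circle kappa.
  by apply: measurable_funTS; exact: measurable_circle_kernel.
have ik : leb.-integrable circle (EFin \o kappa).
  apply/integrableP; split; first exact/measurable_EFinP.
  under eq_integral do rewrite /= ger0_norm ?circle_kernel_ge0//.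
  by rewrite integral_circle_kernel// ltry.
have ik' : leb.-integrable circle (EFin \o (fun u => M * kappa u)).
  by have /(_ (@measurable_circle R)) := integrableZl _ M ik.
apply: le_integrable ik' => //.
- by apply/measurable_EFinP/measurable_funM.
- move=> u /gM guM; rewrite lee_fin !normrM mulrC ler_wpM2r//.
  by rewrite (le_trans guM)// ler_norm.
Qed.

Lemma Rintegral_kernel : \int[leb]_(u in circle) kappa u = 1.
Proof. by rewrite /Rintegral integral_circle_kernel. Qed.

Lemma range_bounded f M :
  (forall y z, unit_itv y -> unit_itv z -> `|f y - f z| <= M) ->
  forall y, unit_itv y -> `|f y| <= `|f 0| + M.
Proof.
move=> fM y Iy; rewrite -[f y](subrK (f 0)) addrC (le_trans (ler_normD _ _))//.
by rewrite lerD2l fM// unit_itvE lexx ler01.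
Qed.

Section oscillation_transport.
Variables (f : R -> R) (M : R).
Hypothesis mf : measurable_fun unit_itv f.
Hypothesis fM : forall y z, unit_itv y -> unit_itv z -> `|f y - f z| <= M.

Let M0 : 0 <= M.
Proof.
by apply: le_trans (fM (y := 0) (z := 0) _ _); rewrite ?unit_itvE ?lexx ?ler01.
Qed.

Let Ifrac (x : R) : unit_itv (frac x).
Proof. by apply: subset_circle; exact: frac_circle. Qed.

Let measurable_shift x : measurable_fun circle (fun u => f (frac (x - u))).
Proof.
apply: measurable_funTS; apply: (measurableT_comp (measurable_frac_comp mf)).
exact: measurable_funB.
Qed.

Let integrable_shift x :
  leb.-integrable circle (EFin \o (fun u => kappa u * f (frac (x - u)))).
Proof.
apply: (@integrable_kernel _ (`|f 0| + M)) => // u _.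
exact: (range_bounded fM).
Qed.

(** A kernel average can be compared with [Q q d f x] under the integral. This
    serves for two values of [Q q d f], and for the constant [f x]. *)
Lemma le_dist_Q (g : R -> R) (a : R) x :
  a = \int[leb]_(u in circle) (kappa u * g u) ->
  measurable_fun circle g -> (forall u, circle u -> `|g u| <= `|f 0| + M) ->
  (`|a - Q q d f x|%:E <=
   \int[leb]_(u in circle) ((kappa u)%:E * `|g u - f (frac (x - u))|%:E))%E.
Proof.
move=> -> mg gM; rewrite QE//.
have ig := integrable_kernel mg gM.
rewrite -RintegralB//.
apply: (@le_trans _ _ (\int[leb]_(u in circle)
  `|kappa u * g u - kappa u * f (frac (x - u))|%:E)%E).
  have iB : leb.-integrable circle
      (EFin \o (fun u => kappa u * g u - kappa u * f (frac (x - u)))).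
    by have /(_ (@measurable_circle R)) :=
      integrableB _ ig (integrable_shift x).
  rewrite EFin_normr_Rintegral//; apply: le_abse_integral => //.
  exact: measurable_int iB.
rewrite le_eqVlt; apply/orP; left; apply/eqP; apply: eq_integral => u _.
by rewrite -mulrBr normrM EFinM ger0_norm// circle_kernel_ge0.
Qed.

(** Rotating by [u] moves the points near [x] to points near [x - u], so the
    oscillation of an average is at most the average of the oscillations. *)
Lemma Osc_Q r x : (Osc (Q q d f) r x <=
  \int[leb]_(u in circle) ((kappa u)%:E * circle_osc f r M (frac (x - u))))%E.
Proof.
apply: Osc_le => y z _ _ yx zx.
have r0 : 0 < r by exact: le_lt_trans yx.
apply: le_trans (le_dist_Q z (QE qN d0 d4 y mf) (measurable_shift y) _) _.
  by move=> u _; exact: (range_bounded fM).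
apply: ge0_le_integral => //.
- by move=> u _; apply: mule_ge0; rewrite lee_fin;
    [exact: circle_kernel_ge0|exact: normr_ge0].
- apply: emeasurable_funM; apply/measurable_EFinP.
    by apply: measurable_funTS; exact: measurable_circle_kernel.
  by apply: measurableT_comp => //; apply: measurable_funB;
    exact: measurable_shift.
- apply: emeasurable_funM.
    by apply/measurable_EFinP/measurable_funTS; exact: measurable_circle_kernel.
  apply: measurable_funTS.
  apply: (measurableT_comp (measurable_circle_osc _ _ _)).
  apply: measurableT_comp; [exact: measurable_frac|exact: measurable_funB].
move=> u _; apply: lee_wpmul2l.
  by rewrite lee_fin; exact: circle_kernel_ge0.
have xuE w : frac (w - u) = frac (frac (x - u) + (w - x)).
  by rewrite frac_fracDl; congr frac; lra.
by rewrite (xuE y) (xuE z); apply: le_circle_osc => //; exact: frac_circle.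
Qed.

(** After exchanging the integrals, rotation invariance makes the inner one
    independent of [u], and the kernel has mass 1. *)
Lemma integral_Osc_Q r : 0 < r ->
  (Osc1 (Q q d f) r <= \int[leb]_(x in circle) circle_osc f r M x)%E.
Proof.
move=> r0; rewrite /Osc1 integral_unit_itv; last first.
  by apply: measurable_funTS; exact: measurable_Osc.
have mco : measurable_fun setT (circle_osc f r M \o frac).
  by apply: measurableT_comp;
    [exact: measurable_circle_osc|exact: measurable_frac].
have co0 x : (0 <= circle_osc f r M (frac x))%E by exact: circle_osc_ge0.
pose G (z : R * R) := ((kappa z.2)%:E * circle_osc f r M (frac (z.1 - z.2)))%E.
have G0 z : (0 <= G z)%E.
  by apply: mule_ge0 => //; rewrite lee_fin; exact: circle_kernel_ge0.
have mG : measurable_fun setT G.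
  apply: emeasurable_funM.
    apply/measurable_EFinP.
    apply: (@measurableT_comp _ _ _ _ _ _ kappa setT (fun z : R * R => z.2)).
      exact: measurable_circle_kernel.
    exact: measurable_snd.
  by apply: (measurableT_comp mco); exact: measurable_funB.
apply: (@le_trans _ _
  (\int[leb]_(x in circle) \int[leb]_(u in circle) G (x, u))%E).
  apply: ge0_le_integral => //.
  - by move=> x /subset_circle; exact: Osc_ge0.
  - by apply: measurable_funTS; exact: measurable_Osc.
  - by apply: measurable_funTS; exact: measurable_integral_circle.
  - by move=> x _; exact: Osc_Q.
rewrite fubini_circle//.
set c := (\int[leb]_(x in circle) circle_osc f r M x)%E.
have c0 : (0 <= c)%E.
  by apply: integral_ge0 => x /subset_circle; exact: circle_osc_ge0.
rewrite (_ : (\int[leb]_(u in circle) _)%E =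
  (\int[leb]_(u in circle) ((kappa u)%:E * c))%E).
  rewrite ge0_integralZr//; last 2 first.
  - by apply/measurable_EFinP/measurable_funTS; exact: measurable_circle_kernel.
  - by move=> u _; rewrite lee_fin; exact: circle_kernel_ge0.
  by rewrite integral_circle_kernel// mul1e.
apply: eq_integral => u _; rewrite /G/= ge0_integralZl//; last 2 first.
- by apply: measurable_funTS; apply: (measurableT_comp mco);
    exact: measurable_funB.
- by rewrite lee_fin; exact: circle_kernel_ge0.
congr (_ * _)%E; rewrite ge0_integral_frac_shift//.
- by apply: measurable_funTS; exact: measurable_circle_osc.
- by move=> x /subset_circle; exact: circle_osc_ge0.
Qed.

(** The kernel only charges rotations by at most [d]. The radius is [2 * d]
    because [Osc] is taken over open balls. *)
Lemma norm1_Q_sub :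
  (norm1 (Q q d f \- f)%R <=
   \int[leb]_(x in circle) circle_osc f (2 * d) M x)%E.
Proof.
have mQf : measurable_fun unit_itv (Q q d f \- f).
  by apply: measurable_funB => //; exact: measurable_Q.
have mQf' : measurable_fun circle (fun x => `|(Q q d f \- f) x|%:E).
  apply/measurable_EFinP; apply: measurableT_comp => //.
  by apply: (measurable_funS _ (@subset_circle R) mQf).
rewrite /norm1 integral_unit_itv//; apply: ge0_le_integral => //.
  by apply: measurable_funTS; exact: measurable_circle_osc.
move=> x cx; have := subset_circle cx; move: (cx);
  rewrite circleE => /andP[x0 x1] Ix.
have [d0' d4'] := (d0, d4); have d2 : 0 < 2 * d by lra.
rewrite /= distrC.
apply: le_trans (le_dist_Q (g := cst (f x)) x _ _ _) _ => //.
- rewrite /= RintegralZr ?Rintegral_kernel ?mul1r//.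
  have := @integrable_kernel (cst 1) 1; rewrite /comp/=.
  under eq_fun do rewrite mulr1.
  by apply=> // u _; rewrite normr1.
- by move=> u _; exact: (range_bounded fM).
have k0 u : 0 <= kappa u by exact: circle_kernel_ge0.
apply: (@le_trans _ _
  (\int[leb]_(u in circle) ((kappa u)%:E * circle_osc f (2 * d) M x))%E).
  apply: ge0_le_integral => //.
  - by move=> u _; apply: mule_ge0; rewrite lee_fin.
  - apply: emeasurable_funM; apply/measurable_EFinP.
      by apply: measurable_funTS; exact: measurable_circle_kernel.
    apply: measurableT_comp => //; apply: measurable_funB => //.
    exact: measurable_shift.
  - apply: emeasurable_funM => //.
    by apply/measurable_EFinP/measurable_funTS; exact: measurable_circle_kernel.
  move=> u; rewrite circleE => /andP[u0 u1].
  have xE : f x = f (frac (x + 0)) by rewrite addr0 frac_id ?x0.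
  have [ud|ud] := leP u d.
    apply: lee_wpmul2l; first by rewrite lee_fin.
    rewrite /= [f x]xE; apply: le_circle_osc => //;
      rewrite ?normr0// normrN ger0_norm//.
    lra.
  have [ud'|ud'] := leP (1 - d) u.
    apply: lee_wpmul2l; first by rewrite lee_fin.
    rewrite /= [f x]xE -(fracDz (x - u) 1) -addrA.
    apply: le_circle_osc => //; rewrite ?normr0// -[1%:~R]/1 ger0_norm; lra.
  rewrite (_ : kappa u = 0) ?mul0e// /circle_kernel !(noise_profile_eq0 qN)
    ?mulr0 ?addr0//.
  - rewrite normrM normfV (gtr0_norm d0) ltr_pdivlMr// mul1r ltr0_norm; lra.
  - by rewrite normrM normfV (gtr0_norm d0) ltr_pdivlMr// mul1r ger0_norm.
rewrite ge0_integralZr//; last 3 first.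
- by apply/measurable_EFinP/measurable_funTS; exact: measurable_circle_kernel.
- by move=> u _; rewrite lee_fin.
- exact: circle_osc_ge0.
by rewrite integral_circle_kernel// mul1e.
Qed.

End oscillation_transport.

(** The variation grows at most by the factor found on the circle: the scale [d]
    of the noise has dropped out of the estimate. *)
Lemma var_fun_Q f p M : measurable_fun unit_itv f -> 1 <= p ->
  (var_fun p f <= M%:E)%E -> (var_fun p (Q q d f) <= (3 * M)%:E)%E.
Proof.
move=> mf p1 fM; apply: ge_ereal_sup => _ [r /= + <-].
rewrite in_itv/= => /andP[r0 r1].
have H : (Osc1 (Q q d f) r <= (3 * r `^ p^-1 * M)%:E)%E.
  apply: le_trans (integral_circle_osc p1 fM r0 r1).
  by apply: integral_Osc_Q => //; move=> y z; exact: range_le fM.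
apply: (le_trans (lee_wpmul2l _ H)); first by rewrite lee_fin powR_ge0.
have rp : r `^ p^-1 != 0 by rewrite gt_eqF// powR_gt0.
rewrite -EFinM lee_fin powRN mulrA [3 * _]mulrC mulrA mulVf// mul1r.
exact: lexx.
Qed.

Lemma norm1_Q_sub_le f p M : measurable_fun unit_itv f -> 1 <= p ->
  (var_fun p f <= M%:E)%E ->
  (norm1 (Q q d f \- f)%R <= (3 * (2 * d) `^ p^-1 * M)%:E)%E.
Proof.
move=> mf p1 fM; apply: (le_trans (norm1_Q_sub mf (fun y z => range_le fM))).
by have [d0' d4'] := (d0, d4); apply: integral_circle_osc => //; lra.
Qed.

End noise_operator.

(** * Additive set functions dominated by a finite measure *)

Section dominated_additive.
Context d (T : measurableType d) (R : realType).
Variables (m : {measure set T -> \bar R}) (K : R) (mu : set T -> R).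
Hypothesis m_fin : (m setT < +oo)%E.
Hypothesis mu_ge0 : forall A, measurable A -> 0 <= mu A.
Hypothesis mu_le : forall A, measurable A -> ((mu A)%:E <= K%:E * m A)%E.
Hypothesis muU : forall A B, measurable A -> measurable B -> A `&` B = set0 ->
  mu (A `|` B) = mu A + mu B.

(** A measure has to be nonnegative on every set, hence the value 0 outside the
    sigma-algebra. *)
Let nu (A : set T) : \bar R := if `[< measurable A >] then (mu A)%:E else 0%E.

Let nuE A : measurable A -> nu A = (mu A)%:E.
Proof. by move=> mA; rewrite /nu asboolT. Qed.

Let mu0 : mu set0 = 0.
Proof.
have := muU measurable0 measurable0 (setI0 set0).
by rewrite setU0 => /eqP; rewrite -subr_eq0 opprD addNKr oppr_eq0 => /eqP.
Qed.

Let nu0 : nu set0 = 0%E.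
Proof. by rewrite nuE// mu0. Qed.

Let nu_ge0 A : (0 <= nu A)%E.
Proof. by rewrite /nu; case: ifPn => // /asboolP /mu_ge0; rewrite lee_fin. Qed.

Let fin_m A : measurable A -> m A \is a fin_num.
Proof.
move=> mA; rewrite ge0_fin_numE//; apply: le_lt_trans m_fin.
by apply: le_measure; rewrite ?inE.
Qed.

Let mu_bigsetU (F : (set T)^nat) n :
  (forall i, measurable (F i)) -> trivIset setT F ->
  mu (\big[setU/set0]_(i < n) F i) = \sum_(i < n) mu (F i).
Proof.
move=> mF tF; elim: n => [|n IH]; first by rewrite !big_ord0.
rewrite !big_ord_recr/= muU ?IH//; first exact: bigsetU_measurable.
rewrite -bigcup_mkord; apply/seteqP; split=> // x [[i /= ni Fi] Fn].
by have /eqP := tF i n I I (ex_intro _ x (conj Fi Fn)); rewrite ltn_eqF.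
Qed.

Let nu_sigma_additive : semi_sigma_additive nu.
Proof.
move=> F mF tF mUF; set U := \bigcup_n F n.
have cm := @measure_semi_sigma_additive _ _ _ m F mF tF mUF.
pose b n := fine (\sum_(0 <= i < n) m (F i))%E.
have cb : b n @[n --> \oo] --> fine (m U).
  by apply: fine_cvg; rewrite fineK//; exact: fin_m.
rewrite nuE// (_ : (fun n => _) = (fun n => (\sum_(0 <= i < n) mu (F i))%:E));
  last first.
  by apply/funext => n; rewrite -sumEFin; apply: eq_bigr => i _; rewrite nuE.
apply: cvg_EFin; first exact: nearW.
suff : (mu U - \sum_(0 <= i < n) mu (F i)) @[n --> \oo] --> 0.
  move=> H; rewrite (_ : _ \o _ =
      (fun n => mu U - (mu U - \sum_(0 <= i < n) mu (F i)))); last first.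
    by apply/funext => n /=; rewrite opprB addrC subrK.
  by rewrite -[X in _ --> X]subr0; apply: cvgB => //; exact: cvg_cst.
have H0 : K * (fine (m U) - b n) @[n --> \oo] --> 0.
  rewrite -(mulr0 K) -(subrr (fine (m U))); apply: cvgM; first exact: cvg_cst.
  by apply: cvgB => //; exact: cvg_cst.
apply: squeeze_cvgr H0; last exact: cvg_cst.
near=> n.
pose V := \big[setU/set0]_(i < n) F i.
have mV : measurable V by exact: bigsetU_measurable.
have VU : V `<=` U by move=> x; rewrite /V -bigcup_mkord => -[i _ Fx]; exists i.
have mUV : measurable (U `\` V) by exact: measurableD.
have -> : mu U - \sum_(0 <= i < n) mu (F i) = mu (U `\` V).
  rewrite big_mkord -mu_bigsetU// -/V -{1}(setDUK VU) muU//; last exact: setDIK.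
  by rewrite addrC addKr.
rewrite mu_ge0//=.
rewrite -lee_fin (le_trans (mu_le mUV))// EFinM EFinB.
have bE : (b n)%:E = m V.
  rewrite /b fineK big_mkord; first by rewrite measure_bigsetU.
  by rewrite -measure_bigsetU//; exact: fin_m.
rewrite bE fineK; last exact: fin_m.
rewrite (_ : m (U `\` V) = m U - m V)%E//.
rewrite measureD//; first by rewrite (setIidr VU).
by apply: le_lt_trans m_fin; apply: le_measure; rewrite ?inE.
Unshelve. all: by end_near. Qed.

(** Finite additivity and domination give countable additivity: what a partial
    union misses has small [m]-measure. *)
Lemma dominated_additive_measure : exists nu : {measure set T -> \bar R},
  forall A, measurable A -> nu A = (mu A)%:E.
Proof.
pose nu' : {measure set T -> \bar R} :=
  HB.pack nu (isMeasure.Build _ _ _ nu nu0 nu_ge0 nu_sigma_additive).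
by exists nu' => A mA; rewrite -nuE.
Qed.

End dominated_additive.

(** * Measurability of the map *)

(** The map is continuous on each open branch, and the finitely many endpoints
    are added one at a time. *)
Lemma measurable_expanding (R : realType) (s eps : R) (tau : R -> R) :
  expanding_class s eps tau -> measurable_fun unit_itv tau.
Proof.
case=> _ _ [k [a [a0 ak alt abr]]] _.
suff H j : (j <= k)%N ->
    measurable_fun (`[a 0%N, a j]%classic : set R) tau /\ a 0%N <= a j.
  by have [] := H k (leqnn _); rewrite a0 ak.
elim: j => [|j IH] jk.
  by rewrite set_itv1; split => //; exact: measurable_fun_set1.
have [mj a0j] := IH (ltnW jk).
have ajj := alt _ jk; split; last exact: (le_trans a0j (ltW ajj)).
rewrite (@itv_bndbnd_setU _ _ _ (BRight (a j))) ?bnd_simp//; last exact: ltW.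
apply/measurable_funU => //; split => //.
apply/measurable_fun_itv_bndo_bndcP.
have [_ [dtau _] _ _] := abr _ jk.
apply: open_continuous_measurable_fun; first exact: interval_open.
move=> x /set_mem/= xj.
exact/differentiable_continuous/derivable1_diffP/dtau.
Qed.

(** * Recovering the norm from integrals over cells *)

Lemma integrable_measurable_fun (R : realType) (D : set R) (f : R -> R) :
  leb.-integrable D (EFin \o f) -> measurable_fun D f.
Proof. by move=> intf; apply/measurable_EFinP; exact: measurable_int intf. Qed.

Section grid.
Variable R : realType.
Implicit Types (f : R -> R) (a r : R).

Lemma ge0_integral_cells (F : R -> \bar R) r (k : nat) : 0 < r ->
  measurable_fun (`[0, k%:R * r[%classic : set R) F ->
  (forall x, x \in `[0, k%:R * r[ -> (0 <= F x)%E) ->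
  (\int[leb]_(x in `[0%R, (k%:R * r)%R[) F x =
   \sum_(i < k) \int[leb]_(x in `[(i%:R * r)%R, (i%:R * r + r)%R[) F x)%E.
Proof.
move=> r0; elim: k => [|k IH].
  by rewrite mul0r set_itvco0 integral_set0 big_ord0.
have kr : k.+1%:R * r = k%:R * r + r by rewrite -natr1 mulrDl mul1r.
have kr0 : 0 <= k%:R * r by rewrite mulr_ge0// ltW.
rewrite kr => mF F0; rewrite big_ord_recr/= -IH; last 2 first.
- by apply: measurable_funS mF => //; apply: subset_itvl; rewrite bnd_simp; lra.
- by move=> x; rewrite in_itv/= => /andP[? ?]; apply: F0; rewrite in_itv/=;
    apply/andP; split; lra.
have E := @itv_bndbnd_setU _ _ (BLeft 0)
  (BLeft (k%:R * r)) (BLeft (k%:R * r + r)).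
rewrite E ?bnd_simp//; [|lra].
apply: ge0_integral_setU => //.
- by rewrite -E ?bnd_simp//; lra.
- by rewrite -E ?bnd_simp//; lra.
- apply/disj_setPS => x [/=]; rewrite !in_itv/= => /andP[_ ?] /andP[? _]; lra.
Qed.

(** On an interval of length [r], [f x] is within [Osc f r x] of the mean of
    [f]. *)
Lemma cell_le f a r : 0 < r -> `[a, a + r[%classic `<=` @circle R ->
  leb.-integrable unit_itv (EFin \o f) ->
  (\int[leb]_(x in `[a, (a + r)%R[) `|f x|%:E <=
   `|\int[leb]_(x in `[a, (a + r)%R[) f x|%:E +
   \int[leb]_(x in `[a, (a + r)%R[) Osc f r x)%E.
Proof.
move=> r0 aC intf; set A := `[a, a + r[%classic.
have mA : measurable (A : set (measurableTypeR R)) by exact: measurable_itv.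
have AI : A `<=` unit_itv by apply: subset_trans (@subset_circle R).
have lA : leb A = r%:E.
  by rewrite /leb lebesgue_measure_itv/= lte_fin ltrDl r0 -EFinB addrAC subrr
    add0r.
have fA : leb.-integrable A (EFin \o f).
  by apply: integrableS intf.
set c := \int[leb]_(x in A) f x.
have mfA : measurable_fun A f by exact: integrable_measurable_fun fA.
have pt x : A x -> (`|f x|%:E <= (r^-1 * `|c|)%:E + Osc f r x)%E.
  move=> Ax; have O0 := Osc_ge0 f r0 (AI _ Ax).
  have H y : A y -> (`|f x - f y|%:E <= Osc f r x)%E.
    move=> Ay; apply: le_Osc; [exact: AI|exact: AI|by rewrite subrr normr0|].
    move: Ax Ay; rewrite /A/= !in_itv/= => /andP[? ?] /andP[? ?].
    by rewrite ltr_norml; apply/andP; split; lra.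
  move: O0 H; case: (Osc f r x) => [w| |//]; last first.
    by move=> _ _; rewrite addey// leey.
  rewrite lee_fin => w0 H; rewrite -EFinD lee_fin.
  have icst z : leb.-integrable A (EFin \o cst z).
    apply/integrableP; split; first exact/measurable_EFinP.
    rewrite (eq_integral (cst `|z|%:E))// integral_cst//=.
    by rewrite [X in (_ * X)%E](_ : _ = leb A)// lA ltry.
  have iB : leb.-integrable A (EFin \o (fun y => f x - f y)).
    by have /(_ mA) := integrableB _ (icst (f x)) fA.
  have fxr : f x * r = c + \int[leb]_(y in A) (f x - f y).
    rewrite RintegralB//; last exact: icst.
    rewrite -/c addrC subrK Rintegral_cst//.
    by rewrite [X in fine X](_ : _ = leb A)// lA.
  have le2 : `|\int[leb]_(y in A) (f x - f y)| <= w * r.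
    apply: (le_trans (le_normr_Rintegral mA iB)).
    apply: (@le_trans _ _ (\int[leb]_(y in A) w)).
      apply: le_Rintegral => //; [|exact: icst].
      by have := integrable_norm iB.
    by rewrite Rintegral_cst// [X in fine X](_ : _ = leb A)// lA.
  rewrite -(ler_pM2r r0) -{1}(gtr0_norm r0) -normrM fxr mulrDl.
  rewrite mulrAC mulVf ?gt_eqF// mul1r.
  by apply: (le_trans (ler_normD _ _)); rewrite lerD2l.
apply: (@le_trans _ _ (\int[leb]_(x in A) ((r^-1 * `|c|)%:E + Osc f r x))%E).
  apply: ge0_le_integral => //.
  - by apply/measurable_EFinP; exact: measurableT_comp.
  - apply: emeasurable_funD => //; apply: measurable_funTS;
      exact: measurable_Osc.
rewrite ge0_integralD//; last 3 first.
- by move=> x _; rewrite lee_fin mulr_ge0// invr_ge0 ltW.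
- by move=> x /AI; exact: Osc_ge0.
- by apply: measurable_funTS; exact: measurable_Osc.
rewrite integral_cst//= [X in (_ * X)%E](_ : _ = leb A)// lA -EFinM.
by rewrite mulrAC mulVf ?gt_eqF// mul1r.
Qed.

Definition cell (N i : nat) : set R :=
  `[i%:R / N.+1%:R, i%:R / N.+1%:R + N.+1%:R^-1[%classic.

Lemma subset_cell N i : (i < N.+1)%N -> cell N i `<=` @circle R.
Proof.
move=> iN x; rewrite /cell circleE/= in_itv/= => /andP[ix xi].
have N0 : 0 < N.+1%:R :> R by rewrite ltr0n.
rewrite (le_trans _ ix) ?divr_ge0//=; apply: (lt_le_trans xi).
by rewrite -[X in _ + X]mul1r -mulrDl natr1 ler_pdivrMr// mul1r ler_nat.
Qed.

(** Up to its oscillation at scale [N.+1%:R^-1], a function is controlled in L^1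
    by finitely many integrals. This is the compactness of the embedding of BV
    in L^1, in the form in which it upgrades weak convergence to convergence in
    norm. *)
Lemma norm1_le_cells f N : leb.-integrable unit_itv (EFin \o f) ->
  (norm1 f <= (\sum_(i < N.+1) `|\int[leb]_(x in cell N i) f x|)%:E +
    Osc1 f N.+1%:R^-1)%E.
Proof.
move=> intf; set r : R := N.+1%:R^-1.
have r0 : 0 < r by rewrite invr_gt0 ltr0n.
have mf : measurable_fun unit_itv f by exact: integrable_measurable_fun intf.
have mfc : measurable_fun circle f.
  by apply: (measurable_funS _ (@subset_circle R) mf);
    exact: measurable_unit_itv.
have Nr : N.+1%:R * r = 1 by rewrite mulfV// gt_eqF// ltr0n.
have mO D : measurable_fun D (Osc f r).
  by apply: measurable_funTS; exact: measurable_Osc.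
rewrite /norm1 /Osc1 !integral_unit_itv//; last first.
  by apply/measurable_EFinP; exact: measurableT_comp.
have cE : circle = `[0%R, (N.+1%:R * r)%R[%classic :> set R by rewrite Nr.
rewrite cE !ge0_integral_cells//; last 2 first.
- move=> x x0; apply: Osc_ge0 => //; apply: subset_circle; rewrite cE;
    exact: x0.
- by rewrite -cE; apply/measurable_EFinP; exact: measurableT_comp.
rewrite -sumEFin -big_split/=; apply: lee_sum => i _.
by apply: cell_le => //; exact: subset_cell.
Qed.

End grid.

(** * Limits of almost invariant densities along an ultrafilter *)

Lemma cvg_near_eq (T : Type) (U : topologicalType) (G : set_system T)
    (FG : Filter G) (f g : T -> U) (l : U) :
  (\forall t \near G, f t = g t) -> f t @[t --> G] --> l ->
    g t @[t --> G] --> l.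
Proof. by move=> fg; apply: cvg_trans; apply: near_eq_cvg; exact: fg. Qed.

(** A cluster point of an ultrafilter is a limit. *)
Lemma ultra_bounded_cvg (R : realType) (T : Type) (G : set_system T)
    (f : T -> R) (a b : R) :
  UltraFilter G -> (\forall t \near G, a <= f t <= b) ->
  exists l : R, f t @[t --> G] --> l.
Proof.
move=> UG fab; have GF : ProperFilter G by exact: ultra_proper.
have Fab : (f @ G) `[a, b]%classic.
  by apply: filterS fab => t /=; rewrite in_itv.
have [l [_ cl]] := @segment_compact R a b (f @ G) _ Fab.
exists l => B Bl; have [//|GnB] := in_ultra_setVsetC (f @^-1` B) UG.
by have [y [/= nBy By]] := cl (~` B) B GnB Bl.
Qed.

Section bounded_densities.
Variables (R : realType) (p M : R).
Implicit Types (g : R -> R) (A : set R).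

Definition bounded_density g := [/\ measurable_fun unit_itv g,
  forall x, 0 <= g x, norm1 g = 1%E & (var_fun p g <= M%:E)%E].

Lemma bounded_density_integrable g : bounded_density g ->
  leb.-integrable unit_itv (EFin \o g).
Proof.
case=> mg g0 g1 _; apply/integrableP; split; first exact/measurable_EFinP.
by move: g1; rewrite /norm1 => ->; rewrite ltry.
Qed.

(** The mean of [g] over an interval of length 1 is 1, so [g] exceeds 1 by at
    most its range. *)
Lemma bounded_density_le g x : bounded_density g -> unit_itv x -> g x <= M + 1.
Proof.
move=> bg Ix; have [mg g0 g1 gM] := bg.
have M0 : 0 <= M by apply: le_trans (range_le gM Ix Ix).
have icst z : (\int[leb]_(y in unit_itv) z%:E)%E = z%:E :> \bar R.
  rewrite integral_cst//= [X in (_ * X)%E](_ : _ = leb (@unit_itv R))//.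
  by rewrite leb_unit_itv mule1.
rewrite -lee_fin -(icst (g x)) EFinD -{1}(icst M) -g1 /norm1.
rewrite -ge0_integralD//=; last first.
  by apply/measurable_EFinP; exact: measurableT_comp.
apply: ge0_le_integral => //.
- by move=> y _; rewrite lee_fin.
- apply: emeasurable_funD => //; apply/measurable_EFinP;
    exact: measurableT_comp.
move=> y Iy; rewrite -EFinD lee_fin (ger0_norm (g0 y)) -lerBlDr.
exact: le_trans (ler_norm _) (range_le gM Ix Iy).
Qed.

Lemma bounded_density_set g A : bounded_density g -> measurable A ->
  leb.-integrable (A `&` unit_itv) (EFin \o g) /\
  (\int[leb]_(x in A `&` unit_itv) g x)%:E =
    (\int[leb]_(x in A `&` unit_itv) (g x)%:E)%E.
Proof.
move=> bg mA; have mAI : measurable (A `&` unit_itv) by exact: measurableI.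
have igA : leb.-integrable (A `&` unit_itv) (EFin \o g).
  apply: integrableS (bounded_density_integrable bg) => //; exact: subIsetr.
split => //; rewrite /Rintegral fineK//; exact: integrable_fin_num.
Qed.

Lemma bounded_density_mass g A : bounded_density g -> measurable A ->
  0 <= \int[leb]_(x in A `&` unit_itv) g x <= 1 /\
  ((\int[leb]_(x in A `&` unit_itv) g x)%:E <=
    (M + 1)%:E * leb (A `&` unit_itv))%E.
Proof.
move=> bg mA; have [mg g0 g1 gM] := bg.
have [igA gE] := bounded_density_set bg mA.
have mAI : measurable (A `&` unit_itv) by exact: measurableI.
have mgA : measurable_fun (A `&` unit_itv) (EFin \o g)
  by exact: measurable_int igA.
split; last first.
  rewrite gE -integral_cst//; apply: ge0_le_integral => //.
  - by move=> x _; rewrite lee_fin.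
  - by move=> x [_ Ix]; rewrite lee_fin bounded_density_le.
rewrite Rintegral_ge0//= -lee_fin gE -g1 /norm1.
under [leRHS]eq_integral do rewrite ger0_norm//.
apply: ge0_subset_integral => //; first exact/measurable_EFinP.
by move=> x _; rewrite lee_fin.
Qed.

End bounded_densities.

Section limit_acip.
Variables (R : realType) (p M : R) (tau : R -> R) (h : R -> R)
  (nu : probability (measurableTypeR R) R)
  (T : Type) (G : set_system T) (g_ : T -> R -> R).
Hypothesis UG : UltraFilter G.
Hypothesis mtau : measurable_fun unit_itv tau.
Hypothesis nu_unique : unique_acip tau nu.
Hypothesis h_density : has_density nu h.
Hypothesis g_bd : \forall t \near G, bounded_density p M (g_ t).
Hypothesis g_inv : forall A : set R, measurable A -> A `<=` unit_itv ->
  (\int[leb]_(x in A) g_ t x - \int[leb]_(x in unit_itv `&` tau @^-1` A) g_ t x)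
    @[t --> G] --> 0.

(** Along an ultrafilter the masses of all measurable sets converge at once. The
    limit is finitely additive and at most [M + 1] times Lebesgue measure, hence
    an absolutely continuous measure; it is invariant by [g_inv], and uniqueness
    identifies it with [nu]. *)
Lemma ultra_limit_density A : measurable A -> A `<=` unit_itv ->
  \int[leb]_(x in A) g_ t x @[t --> G] --> fine (\int[leb]_(x in A) (h x)%:E)%E.
Proof.
have GF : ProperFilter G by exact: ultra_proper.
pose a A t := \int[leb]_(x in A `&` unit_itv) g_ t x.
have [mu mu_cvg] : {mu : set R -> R &
    forall A, measurable A -> a A t @[t --> G] --> mu A}.
  apply: (@choice _ _ (fun A l => measurable A -> a A t @[t --> G] --> l)) => B.
  have [mB|nB] := pselect (measurable B); last by exists 0.
  have [|l al] := @ultra_bounded_cvg R T G (a B) 0 1 UG.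
    by apply: filterS g_bd => t bt; have [] := bounded_density_mass bt mB.
  by exists l.
have mu_unique (B : set R) l :
    measurable B -> a B t @[t --> G] --> l -> mu B = l.
  by move=> mB al; apply: norm_cvg_unique al; exact: mu_cvg.
have mI : measurable (unit_itv : set (measurableTypeR R))
  by exact: measurable_unit_itv.
pose m := mrestr (@lebesgue_measure R) mI.
have mu_ge0 (B : set R) : measurable B -> 0 <= mu B.
  move=> mB; apply: (cvgr_to_ge (mu_cvg B mB)).
  by apply: filterS g_bd => t bt; have [/andP[]] := bounded_density_mass bt mB.
have lebI (B : set R) : measurable B -> leb (B `&` @unit_itv R) \is a fin_num.
  move=> mB; rewrite ge0_fin_numE//.
  have : (leb (B `&` @unit_itv R) <= leb (@unit_itv R))%E.
    by apply: le_measure; rewrite ?inE//; exact: measurableI.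
  by move=> /le_lt_trans; apply; rewrite leb_unit_itv ltry.
have mu_le (B : set R) : measurable B -> ((mu B)%:E <= (M + 1)%:E * m B)%E.
  move=> mB; have -> : m B = (fine (leb (B `&` unit_itv)))%:E
    by rewrite fineK// lebI.
  rewrite -EFinM lee_fin.
  apply: (cvgr_to_le (mu_cvg B mB)); apply: filterS g_bd => t bt.
  have [_ le_mass] := bounded_density_mass bt mB.
  by move: le_mass; rewrite -{1}(fineK (lebI _ mB)) -EFinM lee_fin.
have muU (B C : set R) : measurable B -> measurable C -> B `&` C = set0 ->
  mu (B `|` C) = mu B + mu C.
  move=> mB mC BC; apply: mu_unique; first exact: measurableU.
  apply: (cvg_near_eq _ _ (cvgD (mu_cvg B mB) (mu_cvg C mC))).
  apply: filterS g_bd => t bt; rewrite /= /a setIUl Rintegral_setU//.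
  - exact: measurableI.
  - exact: measurableI.
  - rewrite -setIUl.
    by have [] := bounded_density_set bt (measurableU _ _ mB mC).
  - by rewrite disj_set2E setIACA BC set0I eqxx.
have mT : (m setT < +oo)%E.
  rewrite /m /mrestr setTI [X in (X < _)%E](_ : _ = leb (@unit_itv R))//.
  by rewrite leb_unit_itv ltry.
have [nu' nu'E] := dominated_additive_measure mT mu_ge0 mu_le muU.
have muT : mu setT = 1.
  apply: mu_unique => //; apply: (cvg_near_eq _ _ (cvg_cst (1 : R))).
  apply: filterS g_bd => t [_ g0 g1 _]; rewrite /a setTI /Rintegral.
  under eq_integral do rewrite -[g_ t _]ger0_norm//.
  by move: g1; rewrite /norm1 => ->.
have nu'T : nu' setT = 1%E by rewrite nu'E// muT.
(* The mass is already 1: normalization only provides the structure of a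
   probability. *)
pose P : probability (measurableTypeR R) R := mnormalize nu' nu.
have PE (B : set R) : measurable B -> P B = (mu B)%:E.
  move=> mB; rewrite /P/= /mnormalize nu'T ifF;
    first by rewrite invr1 mule1 nu'E.
  by apply/negbTE; rewrite negb_or oner_neq0.
have mtauA (B : set R) : measurable B ->
  measurable (unit_itv `&` tau @^-1` B) by exact: mtau.
have acipP : acip tau P.
  split.
  - rewrite PE// -muT; congr (_%:E); apply: mu_unique => //.
    by have := mu_cvg setT measurableT; rewrite /a setTI setIid.
  - apply/null_content_dominatesP => B mB B0; rewrite PE//.
    apply/eqP; rewrite eq_le; apply/andP; split; last by rewrite lee_fin mu_ge0.
    apply: (le_trans (mu_le _ mB)); rewrite /m /mrestr.
    rewrite (_ : _ (_ `&` _) = 0%E) ?mule0//.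
    by apply: (subset_measure0 (B := B)) => //; exact: measurableI.
  - move=> B mB BI; rewrite !PE//; last exact: mtauA.
    congr (_%:E); apply: mu_unique; first exact: mtauA.
    rewrite -[X in _ --> X]subr0.
    apply: (cvg_near_eq _ _ (cvgB (mu_cvg B mB) (g_inv mB BI))).
    apply: nearW => t; rewrite /= /a setIAC setIid (setIidl BI).
    by rewrite opprB addrC subrK.
move=> mA AI; have [_ nuh] := h_density.
rewrite -nuh// -(proj2 nu_unique P acipP A mA) PE//=.
by have := mu_cvg A mA; rewrite /a (setIidl AI).
Qed.

End limit_acip.

(** * Elements of L^1 and their representatives *)

#[export] Instance ae_leb_filter (R : realType) :
  Filter (nbhs (almost_everywhere (@leb R))).
Proof. exact: ae_filter_ringOfSetsType. Qed.

Section representatives.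
Variable R : realType.
Implicit Types (f g : R -> R) (p : R).

Lemma ae_eq_integral_EFin f g (A : set R) : measurable A -> A `<=` unit_itv ->
  measurable_fun unit_itv f -> measurable_fun unit_itv g ->
  ae_eq leb unit_itv f g ->
  (\int[leb]_(x in A) (f x)%:E = \int[leb]_(x in A) (g x)%:E)%E.
Proof.
move=> mA AI mf mg fg; apply: ae_eq_integral => //.
- by apply/measurable_EFinP; apply: (measurable_funS _ AI mf);
    exact: measurable_unit_itv.
- by apply/measurable_EFinP; apply: (measurable_funS _ AI mg);
    exact: measurable_unit_itv.
- by apply: filterS fg => x fgx /AI /fgx ->.
Qed.

Lemma ae_eq_norm1 f g :
  measurable_fun unit_itv f -> measurable_fun unit_itv g ->
  ae_eq leb unit_itv f g -> norm1 f = norm1 g.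
Proof.
move=> mf mg fg.
apply: (ae_eq_integral_EFin (f := fun x => `|f x|) (g := fun x => `|g x|)) => //.
- exact: (measurableT_comp (@normr_measurable R setT) mf).
- exact: (measurableT_comp (@normr_measurable R setT) mg).
- by apply: filterS fg => x fgx /fgx ->.
Qed.

Lemma ae_eq_var p f g : ae_eq leb unit_itv f g -> var p f = var p g.
Proof.
move=> fg; congr (ereal_inf (_ @` _)); apply/seteqP; split => k [mk fk];
  split => //.
- exact: ae_eq_trans (ae_eq_sym fg) fk.
- exact: ae_eq_trans fg fk.
Qed.

Lemma var_le p f : measurable_fun unit_itv f -> (var p f <= var_fun p f)%E.
Proof.
move=> mf; apply: ereal_inf_lbound; exists f => //.
by split => //; exact: ae_eq_refl.
Qed.

Lemma var_fun_ge0 p f : (0 <= var_fun p f)%E.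
Proof.
apply: (@le_trans _ _ ((1 `^ (- p^-1))%:E * Osc1 f 1)%E).
  apply: mule_ge0; first by rewrite lee_fin powR_ge0.
  by apply: integral_ge0 => x Ix; exact: Osc_ge0.
by apply: ereal_sup_ubound; exists 1 => //=; rewrite in_itv/= ltr01 lexx.
Qed.

Lemma var_ge0 p f : (0 <= var p f)%E.
Proof. by apply/ereal_infP => _ [g _ <-]; exact: var_fun_ge0. Qed.

Lemma var_ltP p f c : (var p f < c)%E ->
  exists g, [/\ measurable_fun unit_itv g, ae_eq leb unit_itv f g
    & (var_fun p g <= c)%E].
Proof. by move=> /ereal_inf_lt[_ [g [mg fg] <-] /ltW gc]; exists g. Qed.

Lemma var_fun_norm p f : (var_fun p (fun x => `|f x|)%R <= var_fun p f)%E.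
Proof.
apply: ge_ereal_sup => _ [r /= /[dup] r01 + <-];
  rewrite in_itv/= => /andP[r0 r1].
apply: (@le_trans _ _ ((r `^ (- p^-1))%:E * Osc1 f r)%E); last first.
  by apply: ereal_sup_ubound; exists r.
apply: lee_wpmul2l; first by rewrite lee_fin powR_ge0.
apply: ge0_le_integral => //.
- by move=> x; exact: Osc_ge0.
- by apply: measurable_funTS; exact: measurable_Osc.
- by apply: measurable_funTS; exact: measurable_Osc.
move=> x _; apply: Osc_le => y z Iy Iz yx zx;
  apply: (le_trans _ (le_Osc f Iy Iz yx zx)).
by rewrite lee_fin ler_dist_dist.
Qed.

Lemma Osc1_sub f g r : 0 < r -> (Osc1 (f \- g)%R r <= Osc1 f r + Osc1 g r)%E.
Proof.
move=> r0.
have mO k : measurable_fun unit_itv (Osc k r).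
  by apply: measurable_funTS; exact: measurable_Osc.
have O0 k x : unit_itv x -> (0 <= Osc k r x)%E by exact: Osc_ge0.
rewrite /Osc1 -ge0_integralD//; [|exact: O0|exact: mO|exact: O0|exact: mO].
apply: ge0_le_integral => //.
- by move=> x; exact: Osc_ge0.
- exact: mO.
- by apply: emeasurable_funD; exact: mO.
move=> x _; apply: Osc_le => y z Iy Iz yx zx.
apply: (@le_trans _ _ (`|f y - f z|%:E + `|g y - g z|%:E)%E).
  rewrite -EFinD lee_fin /=.
  have -> : f y - g y - (f z - g z) = (f y - f z) - (g y - g z) by lra.
  exact: ler_normB.
by apply: leeD; exact: le_Osc.
Qed.

(** The absolute value makes a representative nonnegative everywhere without
    increasing its oscillation. *)
Lemma bounded_density_repr p M f : leb.-integrable unit_itv (EFin \o f) ->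
  density f -> (var p f < M%:E)%E ->
  exists2 g, bounded_density p M g & ae_eq leb unit_itv f g.
Proof.
move=> intf [f0 f1] /var_ltP[g [mg fg gM]].
have mf : measurable_fun unit_itv f by exact: integrable_measurable_fun intf.
have mg' : measurable_fun unit_itv (fun x => `|g x|).
  exact: (measurableT_comp (@normr_measurable R setT) mg).
have fg' : ae_eq leb unit_itv f (fun x => `|g x|).
  by move: f0 fg; apply: filterS2 => x fx0 fgx Ix;
    rewrite -fgx// ger0_norm// fx0.
exists (fun x => `|g x|) => //; split => //.
- by rewrite -(ae_eq_norm1 mf mg' fg').
- exact: le_trans (var_fun_norm _ _) gM.
Qed.

Section noise.
Variables (q : R -> R) (d : R).
Hypotheses (qN : noise_profile q) (d0 : 0 < d) (d4 : d < 1 / 4).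

Lemma ae_eq_Q f g : measurable_fun unit_itv f -> measurable_fun unit_itv g ->
  ae_eq leb unit_itv f g -> Q q d f = Q q d g.
Proof.
move=> mf mg fg; apply/funext => x; rewrite /Q /Rintegral; congr fine.
have mq : measurable_fun unit_itv (q_per q d x).
  rewrite (_ : q_per q d x = circle_kernel q d \o (fun y => frac (x - y)));
    last first.
    by apply/funext => y; exact: q_perE.
  apply: measurable_funTS.
  apply: (measurableT_comp (measurable_circle_kernel d qN)).
  by apply: measurableT_comp; [exact: measurable_frac|exact: measurable_funB].
apply: (ae_eq_integral_EFin (f := fun y => q_per q d x y * f y)
  (g := fun y => q_per q d x y * g y)) => //.
- exact: measurable_funM.
- exact: measurable_funM.
- by apply: filterS fg => y fgy /fgy ->.
Qed.

(** The bounds for the noise pass to the variation of an element of L^1 because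
    [Q] only depends on its argument up to a null set. *)
Lemma Q_near_repr p c f : 1 <= p -> measurable_fun unit_itv f ->
  (var p f < c%:E)%E ->
  (var p (Q q d f) <= (3 * c)%:E)%E /\
  (norm1 (Q q d f \- f)%R <= (3 * (2 * d) `^ p^-1 * c)%:E)%E.
Proof.
move=> p1 mf /var_ltP[g [mg fg gc]].
rewrite (ae_eq_Q mf mg fg); split.
  apply: le_trans (var_fun_Q qN d0 d4 mg p1 gc); apply: var_le;
    exact: measurable_Q.
rewrite (@ae_eq_norm1 _ (Q q d g \- g)%R); first exact: norm1_Q_sub_le.
- by apply: measurable_funB => //; exact: measurable_Q.
- by apply: measurable_funB => //; exact: measurable_Q.
- by apply: filterS fg => x fgx /fgx /= ->.
Qed.

End noise.

Lemma C1tilde_ge3 p (q : R -> R) : 0 < p -> 3 <= C1tilde p q.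
Proof.
move=> p0; rewrite /C1tilde.
have p1 : 0 <= p^-1 by rewrite invr_ge0 ltW.
have t1 : 1 <= 2 `^ p^-1 :> R.
  by have := @ler_powR R 2 (ler1n _ 2) _ _ p1; rewrite powRr0.
have t2 : 2 <= 2 `^ (1 + p^-1) :> R.
  have p2 : 1 <= 1 + p^-1 by rewrite lerDl.
  by have := @ler_powR R 2 (ler1n _ 2) _ _ p2; rewrite powRr1.
have m1 : 1 <= Num.max 1 (4 * fine (norm_infty (derive1 q)))
  by rewrite le_max lexx.
have t12 : 3 <= (1 + 2 `^ (1 + p^-1)) * 2 `^ p^-1 :> R.
  by rewrite -[leLHS]mulr1; apply: ler_pM => //; lra.
by rewrite -[leLHS]mulr1; apply: ler_pM => //; lra.
Qed.

(** If no function satisfied the identity that defines the Frobenius-Perron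
    operator at [f], then [FP tau f] and with it [f] would vanish, against
    [norm1 f = 1]. *)
Lemma invariant_FP (tau : R -> R) (q : R -> R) d f :
  invariant_density (fun f => Q q d (FP tau f)) f ->
  leb.-integrable unit_itv (EFin \o f) -> is_FP tau f (FP tau f).
Proof.
move=> [Qf [_ f1]] intf; have [exFP|noFP] := pselect (exists g, is_FP tau f g).
  exact: (xgetPex (cst 0) exFP).
exfalso; move: Qf f1; rewrite /FP xgetPN//=; last first.
  by move=> g gFP; apply: noFP; exists g.
move=> Qf.
have mf : measurable_fun unit_itv f by exact: integrable_measurable_fun intf.
have Q0 : Q q d (cst 0) = cst 0.
  by apply/funext => x; rewrite /Q; under eq_Rintegral do rewrite mulr0;
    rewrite Rintegral_cst// mul0r.
rewrite Q0 in Qf; rewrite -(ae_eq_norm1 _ mf Qf)// /norm1.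
under eq_integral do rewrite normr0.
by rewrite integral0 => /eqP; rewrite eq_sym onee_eq0.
Qed.

End representatives.

(** * Uniform bounds for the stationary densities of the noisy system *)

(** Let [V] be the variation of [f]. The Lasota-Yorke inequality followed by the
    factor 3 of the noise gives [V <= 3 * (alpha0 * (V + 1) + C0 + 1)], and
    [3 * alpha0 < 1] turns this into a bound free of [d]. The defect of
    invariance of [f] is then the distance from [FP tau f] to its image by the
    noise, which is small because [FP tau f] has bounded variation too. *)
Lemma noisy_density_bounds (R : realType) (p s alpha0 C0 : R) (tau q : R -> R) :
  1 <= p -> measurable_fun unit_itv tau -> noise_profile q ->
  lasota_yorke p s tau alpha0 C0 -> alpha0 < 1 / C1tilde p q ->
  exists M : R, 0 <= M /\ forall (d : R) (f : R -> R),
    0 < d < 1 / 4 -> BV p f ->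
    invariant_density (fun f => Q q d (FP tau f)) f ->
    exists g, [/\ bounded_density p M g, ae_eq leb unit_itv f g
      & forall A : set R, measurable A -> A `<=` unit_itv ->
        `|\int[leb]_(x in A) g x -
          \int[leb]_(x in unit_itv `&` tau @^-1` A) g x| <=
          3 * (2 * d) `^ p^-1 * M].
Proof.
move=> p1 mtau qN [/andP[a0 a1] C00 _ LY] aC.
have p0 : 0 < p by exact: lt_le_trans p1.
have C3 := C1tilde_ge3 q p0.
have a3 : 0 < 1 - 3 * alpha0.
  have : alpha0 * C1tilde p q < 1.
    by rewrite -ltr_pdivlMr//; exact: lt_le_trans C3.
  by nra.
(* [B] is the fixed point of the affine bound on the variation; its additive 1
   makes the bound strict, so that it is met by a representative. *)
pose B := 3 * (alpha0 + C0 + 1) / (1 - 3 * alpha0).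
have B0 : 0 <= B by rewrite /B divr_ge0//; lra.
have BE : B * (1 - 3 * alpha0) = 3 * (alpha0 + C0 + 1)
  by rewrite /B divfK// gt_eqF.
pose M := B + 1 + (alpha0 * (B + 1) + C0 + 1).
have M0 : 0 <= M by rewrite /M; nra.
exists M; split => // d f /andP[d0 d4] [intf fvar] finv.
have := invariant_FP finv intf; have [] := finv.
set P := FP tau f => QPf [f0 f1] [intP FPE].
have mf : measurable_fun unit_itv f by exact: integrable_measurable_fun intf.
have mP : measurable_fun unit_itv P by exact: integrable_measurable_fun intP.
have [V VE] : exists V : R, var p f = V%:E.
  apply/EFin_fin_numP; rewrite ge0_fin_numE//; exact: var_ge0.
have V0 : 0 <= V by rewrite -lee_fin -VE var_ge0.
have varP : (var p P < (alpha0 * (V + 1) + C0 + 1)%:E)%E.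
  apply: (@le_lt_trans _ _ (alpha0 * (V + 1) + C0)%:E);
    last by rewrite lte_fin ltrDl.
  by have := LY f (conj intf fvar); rewrite /normBV VE f1 mule1.
have [varQP _] := Q_near_repr qN d0 d4 p1 mP varP.
have VB : V <= B.
  rewrite -(ler_pM2r a3) BE.
  move: varQP; rewrite (ae_eq_var p QPf) VE lee_fin; nra.
have varPM : (var p P < M%:E)%E.
  by apply: (lt_le_trans varP); rewrite lee_fin /M; nra.
have fM : (var p f < M%:E)%E by rewrite VE lte_fin /M; nra.
have [g bg fg] := bounded_density_repr intf (conj f0 f1) fM.
exists g; split => // A mA AI.
have [mg _ _ _] := bg.
have mtauA : measurable (unit_itv `&` tau @^-1` A) by exact: mtau.
have [_ QPP] := Q_near_repr qN d0 d4 p1 mP varPM.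
have mQP := measurable_Q qN d0 d4 mP.
have gA : \int[leb]_(x in A) g x = \int[leb]_(x in A) Q q d P x.
  congr fine; apply: ae_eq_integral_EFin => //.
  exact: ae_eq_trans (ae_eq_sym fg) (ae_eq_sym QPf).
have gtauA : \int[leb]_(x in unit_itv `&` tau @^-1` A) g x =
  \int[leb]_(x in A) P x.
  rewrite /Rintegral FPE//; congr fine; apply: ae_eq_integral_EFin => //.
  exact: ae_eq_sym.
have iQP : leb.-integrable unit_itv (EFin \o Q q d P).
  apply/integrableP; split; first exact/measurable_EFinP.
  rewrite [ltLHS](_ : _ = norm1 (Q q d P))// (ae_eq_norm1 mQP mf QPf) f1.
  exact: ltry.
have iA k : leb.-integrable unit_itv (EFin \o k) ->
  leb.-integrable A (EFin \o k).
  by apply: integrableS.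
rewrite gA gtauA -RintegralB//; [|exact: iA|exact: iA].
rewrite -lee_fin; apply: le_trans QPP.
have iB : leb.-integrable A (EFin \o (fun x => Q q d P x - P x)).
  by have /(_ mA) := integrableB _ (iA _ iQP) (iA _ intP).
apply: (@le_trans _ _ (\int[leb]_(x in A) `|Q q d P x - P x|%:E)%E).
  rewrite EFin_normr_Rintegral//; apply: le_abse_integral => //.
  exact: measurable_int iB.
apply: ge0_subset_integral => //.
apply/measurable_EFinP.
apply: (measurableT_comp (@normr_measurable R setT)).
exact: measurable_funB.
Qed.

(** * Stochastic stability *)

(** The trace of [F] on the complement of [S] is a proper filter. *)
Lemma not_cvg_ultra (T : Type) (F : set_system T) (S : set T) :
  ProperFilter F -> ~ F S ->
  exists G : set_system T, [/\ UltraFilter G, F `<=` G & G (~` S)].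
Proof.
move=> FF nFS.
have WF : ProperFilter (within (~` S) F).
  apply: Build_ProperFilter => W0; apply: nFS.
  have {}W0 : F [set x | ~ S x -> False] := W0.
  by apply: filterS W0 => x; exact: contrapT.
have [G [UG WG]] := ultraFilterLemma WF; exists G; split => //.
- move=> A FA; apply: WG; apply: filterS FA => x Ax _; exact: Ax.
- by apply: WG; exact: withinT.
Qed.

Theorem theorem4p3 (R : realType) (p s eps alpha0 C0 : R) (tau q : R -> R)
    (nu : probability (measurableTypeR R) R) (h : R -> R) (h_ : R -> R -> R)
    (p_ge1 : 1 <= p) (s_gt1 : 1 < s) (eps_gt0 : 0 < eps)
    (tauT : expanding_class s eps tau)
    (qN : noise_profile q)
    (LY : lasota_yorke p s tau alpha0 C0)
    (joint : alpha0 < 1 / C1tilde p q)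
    (mixing : topologically_mixing tau)
    (nu_unique : unique_acip tau nu)
    (h_density : has_density nu h)
    (hBV : BV p h)
    (h_P : forall delta, 0 < delta < 1 / 4 ->
       BV p (h_ delta) /\
       invariant_density (fun f => Q q delta (FP tau f)) (h_ delta)) :
  norm1 (h_ delta \- h) @[delta --> 0^'+] --> 0%E.
Proof.
have p0 : 0 < p by exact: lt_le_trans p_ge1.
have mtau := measurable_expanding tauT.
have [M [M0 HM]] := noisy_density_bounds p_ge1 mtau qN LY joint.
have [g_ gP] : {g_ : R -> R -> R & forall d, 0 < d < 1 / 4 ->
    [/\ bounded_density p M (g_ d), ae_eq leb unit_itv (h_ d) (g_ d)
      & forall A : set R, measurable A -> A `<=` unit_itv ->
        `|\int[leb]_(x in A) g_ d x -
          \int[leb]_(x in unit_itv `&` tau @^-1` A) g_ d x| <=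
          3 * (2 * d) `^ p^-1 * M]}.
  apply: (@choice _ _ (fun d g => 0 < d < 1 / 4 -> [/\ bounded_density p M g,
      ae_eq leb unit_itv (h_ d) g & forall A : set R, measurable A ->
        A `<=` unit_itv ->
        `|\int[leb]_(x in A) g x -
          \int[leb]_(x in unit_itv `&` tau @^-1` A) g x| <=
          3 * (2 * d) `^ p^-1 * M])) => d.
  have [d04|nd] := pselect (is_true (0 < d < 1 / 4)); last by exists (cst 0).
  have [hd_BV hd_inv] := h_P d d04.
  by have [g gP] := HM d (h_ d) d04 hd_BV hd_inv; exists g.
have near_d : \forall d \near (0 : R)^'+, 0 < d < 1 / 4.
  by near=> d; apply/andP; split.
have [inth hvar] := hBV.
have mh : measurable_fun unit_itv h by exact: integrable_measurable_fun inth.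
have [Mh hMh] : exists Mh : R, (var p h < Mh%:E)%E.
  have /EFin_fin_numP[V ->] : var p h \is a fin_num
    by rewrite ge0_fin_numE// var_ge0.
  by exists (V + 1); rewrite lte_fin ltrDl.
have [k [mk hk kMh]] := var_ltP hMh.
have ik : leb.-integrable unit_itv (EFin \o k).
  apply/integrableP; split; first exact/measurable_EFinP.
  rewrite [ltLHS](_ : _ = norm1 k)// -(ae_eq_norm1 mh mk hk).
  by have [[_ ->] _] := h_density; exact: ltry.
pose c := 3 * 2 `^ p^-1 * M.
have c0 : c * d `^ p^-1 @[d --> (0 : R)^'+] --> 0.
  rewrite -[X in _ --> X](mulr0 c); apply: cvgM; first exact: cvg_cst.
  by apply: powR_cvg0; rewrite invr_gt0.
(* If the norms do not become small, some ultrafilter concentrates on the noise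
   levels where they are not; but the limit along it is [nu]. *)
have near_lt e : 0 < e ->
    \forall d \near (0 : R)^'+, (norm1 (h_ d \- h)%R < e%:E)%E.
  move=> e0; apply: contrapT => nF.
  have [G [UG FG Gbad]] := not_cvg_ultra (at_right_proper_filter (0 : R)) nF.
  have GF : ProperFilter G by exact: ultra_proper.
  have Gd := FG _ near_d.
  have Ginv (A : set R) : measurable A -> A `<=` unit_itv ->
      (\int[leb]_(x in A) g_ t x -
       \int[leb]_(x in unit_itv `&` tau @^-1` A) g_ t x) @[t --> G] --> 0.
    move=> mA AI; apply: (@cvg_trans _ ((\int[leb]_(x in A) g_ t x
      - \int[leb]_(x in unit_itv `&` tau @^-1` A) g_ t x) @[t --> 0^'+])).
      by move=> Y; exact: FG.
    apply: (squeeze_cvgr (f := fun d => - (c * d `^ p^-1))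
      (h := fun d => c * d `^ p^-1)).
    - apply: filterS near_d => d d04; rewrite -ler_norml.
      have [_ _ /(_ A mA AI) /le_trans] := gP d d04; apply.
      have /andP[/ltW d0 _] := d04.
      by rewrite powRM ?ler0n// /c; lra.
    - by rewrite -[X in _ --> X]oppr0; exact: cvgN.
    - exact: c0.
  have Gbd : \forall t \near G, bounded_density p M (g_ t).
    by apply: filterS Gd => d /gP[].
  have Gcvg := ultra_limit_density UG mtau nu_unique h_density Gbd Ginv.
  (* The oscillation at the scale of the cells takes half of [e]; the integrals
     over the cells, whose number is now fixed, share the other half. *)
  have [N Ne] : exists N : nat, N.+1%:R^-1 `^ p^-1 * (M + Mh) < e / 2.
    have : d `^ p^-1 * (M + Mh) @[d --> (0 : R)^'+] --> 0.
      rewrite -[X in _ --> X](mul0r (M + Mh)); apply: cvgM; last exact: cvg_cst.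
      by apply: powR_cvg0; rewrite invr_gt0.
    move=> /cvgr0Pnorm_lt/(_ _ (divr_gt0 e0 (ltr0n _ 2))).
    move=> [r r0 Hr].
    have [N _ /(_ N (leqnn _)) Nr] := near_infty_natSinv_lt (PosNum r0).
    exists N; apply: le_lt_trans (Hr N.+1%:R^-1 _ _) => //;
      first exact: ler_norm.
    by rewrite /ball_/= sub0r normrN gtr0_norm.
  have cellI i : (i < N.+1)%N -> cell N i `<=` (@unit_itv R).
    by move=> iN; apply: subset_trans (@subset_circle R); exact: subset_cell.
  have Gcell : \forall d \near G, forall i : 'I_N.+1,
      `|\int[leb]_(x in cell N i) g_ d x -
        fine (\int[leb]_(x in cell N i) (h x)%:E)%E| < e / 2 / N.+1%:R.
    apply: filter_forall => i.
    have mc : measurable (cell N i : set R) by exact: measurable_itv.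
    have /cvgrPdist_lt/(_ (e / 2 / N.+1%:R)) := Gcvg _ mc (cellI i (ltn_ord i)).
    move=> /(_ (divr_gt0 (divr_gt0 e0 (ltr0n _ 2)) (ltr0n _ N.+1))).
    by apply: filterS => d; rewrite distrC.
  have [d [[[Gd1 Gd2] Gd3] Gd4]] :=
    filter_ex (filterI (filterI (filterI Gd Gbd) Gcell) Gbad).
  apply: Gd4; have [_ hg _] := gP d Gd1.
  have [mg _ _ gM] := Gd2; have ig := bounded_density_integrable Gd2.
  have [[inthd _] _] := h_P d Gd1.
  have mhd : measurable_fun unit_itv (h_ d).
    exact: integrable_measurable_fun inthd.
  have ikg : leb.-integrable unit_itv (EFin \o (g_ d \- k)).
    by have /(_ (@measurable_unit_itv R)) := integrableB _ ig ik.
  rewrite (_ : norm1 _ = norm1 (g_ d \- k)); last first.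
    apply: ae_eq_norm1; [exact: measurable_funB|exact: measurable_funB|].
    by move: hg hk; apply: filterS2 => x hgx hkx Ix /=; rewrite hgx// hkx.
  have N0 : 0 < N.+1%:R^-1 :> R by rewrite invr_gt0.
  have N1 : N.+1%:R^-1 <= 1 :> R by rewrite invf_le1// ler1n.
  apply: (le_lt_trans (norm1_le_cells N ikg)).
  have Osc_small : (Osc1 (g_ d \- k)%R N.+1%:R^-1 <=
    (N.+1%:R^-1 `^ p^-1 * (M + Mh))%:E)%E.
    apply: (le_trans (Osc1_sub _ _ N0)); rewrite mulrDr EFinD.
    by apply: leeD; exact: Osc1_le.
  apply: (le_lt_trans (leeD (lexx _) Osc_small)); rewrite -EFinD lte_fin.
  apply: (@lt_le_trans _ _ (e / 2 + e / 2)); last lra.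
  apply: ler_ltD => //.
  apply: (@le_trans _ _ (\sum_(i < N.+1) e / 2 / N.+1%:R)); last first.
    by rewrite sumr_const card_ord -[leLHS]mulr_natr divfK.
  apply: ler_sum => i _; apply: le_trans (ltW (Gd3 i)).
  have mc : measurable (cell N i : set R) by exact: measurable_itv.
  have iS (F : R -> R) : leb.-integrable unit_itv (EFin \o F) ->
    leb.-integrable (cell N i) (EFin \o F).
    move=> iF; apply: (integrableS _ _ _ iF);
      [exact: measurable_unit_itv|exact: measurable_itv|].
    exact: (cellI _ (ltn_ord i)).
  rewrite RintegralB//; [|exact: iS|exact: iS].
  rewrite [X in _ <= `|_ - X|](_ : _ = \int[leb]_(x in cell N i) k x)//.
  by congr fine; apply: ae_eq_integral_EFin => //; exact: (cellI _ (ltn_ord i)).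
have h_fin : \forall d \near (0 : R)^'+, norm1 (h_ d \- h) \is a fin_num.
  apply: filterS (near_lt 1 ltr01) => d; rewrite ge0_fin_numE.
    by move=> /lt_trans; apply; exact: ltry.
  by apply: integral_ge0 => x _; rewrite lee_fin.
apply: cvg_EFin => //; apply/cvgr0Pnorm_lt => e e0.
apply: filterS2 h_fin (near_lt e e0) => d dfin dlt /=.
by rewrite ger0_norm -?lte_fin ?fineK// fine_ge0//; apply: integral_ge0.
Unshelve. all: by end_near. Qed.
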